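(* Let $A:\mathbb R^d\to\mathbb R^d$ be a $C^3$ orientation-preserving diffeomorphism, $M(x):=DA(x)^{-1}$, and let $\pi_A$ be the Gaussian-conjugate target and $K_A^{(1)}(x,x')=M(x)M(x')^\top$. Let $X_i^N(0)$, $1\le i\le N$, be i.i.d. with law $\mu_0$ (generic copy $X(0)$). If $\mathbb E\|A(X(0))\|^2<\infty$, then the matrix-SVGD flow for $(\pi_A,K_A^{(1)})$, with $\mu_t$ the mean-field solution started from $\mu_0$ and $\mu_t^N$ the empirical measure of the $N$-particle system started from $(X_i^N(0))_i$, satisfies $$\mathbb E\Big[\sup_{t\ge0}d_{A,1}^2(\mu_t^N,\mu_t)\Big]\le\frac{\mathrm{Tr}\,\mathrm{Cov}(A(X(0)))}N,$$ where $d_{A,1}(\rho,\nu):=\big\|\int A\,d\rho-\int A\,d\nu\big\|$. The same estimate holds with $\mu_t^N,\mu_t$ replaced by their time averages $\frac1T\int_0^T\mu_t^Ndt$ and $\frac1T\int_0^T\mu_tdt$ (supremum over $T>0$).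
   Context: **Matrix-kernel SVGD.** For $\pi\propto e^{-V}$ on $\mathbb R^d$ and a positive-definite matrix kernel $K:\mathbb R^d\times\mathbb R^d\to\mathbb R^{d\times d}$, set $v_\rho(x):=\int\{-K(x,y)\nabla V(y)+\mathrm{div}_yK(x,y)\}\rho(dy)$, with $[\mathrm{div}_yK(x,y)]_a:=\sum_b\partial_{y_b}K_{ab}(x,y)$. The mean-field flow is the weak solution of $\partial_t\mu_t+\nabla\cdot(v_{\mu_t}\mu_t)=0$ with initial law $\mu_0$; the $N$-particle system is $\dot X_i^N(t)=v_{\mu_t^N}(X_i^N(t))$, $\mu_t^N=\frac1N\sum_i\delta_{X_i^N(t)}$. Well-posedness of these flows is transferred from the Gaussian base system through the diffeomorphism $A$. **Gaussian-conjugate target.** $\pi_A(dx)=(2\pi)^{-d/2}e^{-V_A(x)}dx$ with $V_A(x)=-\log\det DA(x)+\frac12\|A(x)\|^2$; equivalently $A_\#\pi_A$ is the standard Gaussian $\gamma_d$ on $\mathbb R^d$. *)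

(* Defs.v *)
From HB Require Import structures.
From mathcomp Require Import all_boot all_order all_algebra.
From mathcomp Require Import all_classical all_reals all_analysis.

Set Implicit Arguments.
Unset Strict Implicit.
Unset Printing Implicit Defensive.

Import Order.TTheory GRing.Theory Num.Theory.
Import numFieldNormedType.Exports.

Local Open Scope classical_set_scope.
Local Open Scope ring_scope.

(* Points of R^d are row vectors.  The norm `|x| of the library on 'rV[R]_d is
   the sup norm, whence the separate Euclidean norm [enorm].  The Borel
   sigma-algebra is carried by the alias [borelRV], convertible to 'rV[R]_d. *)
Definition borelRV (R : realType) (d : nat) :=
  g_sigma_algebraType (@open 'rV[R]_d).

Section calculus.
Context {R : realType} {d : nat}.
Local Notation E := 'rV[R]_d.

Definition enorm (u : E) : R := Num.sqrt (\sum_(a < d) u 0 a ^+ 2).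

Definition partial (b : 'I_d) (f : E -> R) (x : E) : R :=
  'D_(delta_mx 0 b : E) f x.

Definition grad (f : E -> R) (x : E) : E := \row_b partial b f x.

Fixpoint Ck (k : nat) (f : E -> R) : Prop :=
  if k is k'.+1 then
    (forall x, differentiable f x) /\ (forall b, Ck k' (partial b f))
  else continuous f.

Definition Ck_map (k : nat) (F : E -> E) : Prop :=
  forall a, Ck k (fun x => F x 0 a).

Definition Ck_diffeo (k : nat) (F : E -> E) : Prop :=
  Ck_map k F /\
  exists G : E -> E, [/\ cancel F G, cancel G F & Ck_map k G].

(* The library's ['J F x] acts on row vectors from the right, so it is the
   transpose of the usual DF(x) = (d_b F_a)_(a, b). *)
Definition Dmx (F : E -> E) (x : E) : 'M[R]_d := ('J F x)^T.

Definition orientation_preserving (F : E -> E) : Prop :=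
  forall x, 0 < \det (Dmx F x).

Definition Cc1 (phi : E -> R) : Prop :=
  Ck 1 phi /\
  exists2 B : set E, compact B & forall x, ~ B x -> phi x = 0.

End calculus.

Section measures.
Context {R : realType} {d : nat}.
Local Notation E := (borelRV R d).

(* Coordinatewise integral; rho is only required to be a set function so that
   it applies to [time_average] below without a measurability side condition. *)
Definition vint (rho : set E -> \bar R) (f : E -> 'rV[R]_d) : 'rV[R]_d :=
  \row_a fine (\int[rho]_x (f x 0 a)%:E)%E.

Definition empirical (N : nat) (x : 'I_N -> E) (B : set E) : \bar R :=
  ((N%:R^-1)%:E * \sum_(i < N) \d_(x i) B)%E.

Section empirical_measure.
Variables (N : nat) (x : 'I_N -> E).

Let empirical0 : empirical x set0 = 0%E.
Proof. by rewrite /empirical big1 ?mule0// => i _; rewrite measure0. Qed.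

Let empirical_ge0 B : (0 <= empirical x B)%E.
Proof.
by rewrite /empirical mule_ge0 ?lee_fin ?invr_ge0// sume_ge0.
Qed.

Let empirical_sigma_additive : semi_sigma_additive (empirical x).
Proof.
pose m (k : nat) : {measure set E -> \bar R} :=
  if insub k is Some i then \d_(x i) else mzero.
have -> : empirical x =
    mscale (NngNum (ltac:(by rewrite invr_ge0) : 0 <= N%:R^-1 :> R)) (msum m N).
  apply/funext => B; rewrite /empirical /mscale /msum /=.
  by congr (_ * _)%E; apply: eq_bigr => i _; rewrite /m valK.
exact: measure_semi_sigma_additive.
Qed.

HB.instance Definition _ := isMeasure.Build _ _ _ (empirical x)
  empirical0 empirical_ge0 empirical_sigma_additive.

End empirical_measure.

Definition time_average (T : R) (mu : R -> set E -> \bar R) (B : set E) :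
  \bar R := ((T^-1)%:E * \int[lebesgue_measure]_(t in `[0%R, T]) mu t B)%E.

Definition dA1 (A : 'rV[R]_d -> 'rV[R]_d) (rho nu : set E -> \bar R) : R :=
  enorm (vint rho A - vint nu A).

End measures.

Section matrix_svgd.
Context {R : realType} {d : nat}.
Local Notation E := (borelRV R d).
Local Notation kernel := ('rV[R]_d -> 'rV[R]_d -> 'M[R]_d).
Implicit Types (V : 'rV[R]_d -> R) (K : kernel).

Definition div2 K (x y : 'rV[R]_d) : 'rV[R]_d :=
  \row_a \sum_(b < d) partial b (fun z => K x z a b) y.

(* [grad V y *m (K x y)^T] is the row form of K(x,y) grad V(y). *)
Definition drift V K (x y : 'rV[R]_d) : 'rV[R]_d :=
  - (grad V y *m (K x y)^T) + div2 K x y.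

Definition velocity V K (rho : set E -> \bar R) (x : 'rV[R]_d) : 'rV[R]_d :=
  vint rho (drift V K x).

Definition flux V K (rho : set E -> \bar R) (phi : 'rV[R]_d -> R) : R :=
  fine (\int[rho]_x
    (\sum_(a < d) partial a phi x * velocity V K rho x 0 a)%:E)%E.

(* Weak solutions on [0, +oo[ of d_t mu + div (v_mu mu) = 0: narrowly
   continuous curves of probability measures whose velocity field is well
   defined, locally bounded in space and locally integrable in time; negative
   times are irrelevant. *)
Record mean_field_solution V K (mu0 : probability E R)
    (mu : R -> probability E R) : Prop := MeanFieldSolution {
  mf_init : forall B : set E, measurable B -> mu 0 B = mu0 B ;
  mf_narrow : forall f : 'rV[R]_d -> R, continuous f ->
    (exists C, forall x, `|f x| <= C) ->
    {within `[0, +oo[, continuous (fun t => \int[mu t]_x f x)} ;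
  mf_integrable : forall t, 0 <= t -> forall (x : 'rV[R]_d) a,
    (mu t).-integrable setT (fun y : E => (drift V K x y 0 a)%:E) ;
  mf_locally_bounded : forall (B : set 'rV[R]_d) (T : R), compact B ->
    exists2 g : R -> R, lebesgue_measure.-integrable `[0, T] (EFin \o g) &
    forall t x, t \in `[0, T] -> B x -> enorm (velocity V K (mu t) x) <= g t ;
  mf_weak : forall phi : 'rV[R]_d -> R, Cc1 phi -> forall t, 0 <= t ->
    lebesgue_measure.-integrable `[0, t]
      (fun s => (flux V K (mu s) phi)%:E) /\
    \int[mu t]_x phi x - \int[mu0]_x phi x =
      \int[lebesgue_measure]_(s in `[0, t]) flux V K (mu s) phi }.

Record particle_solution V K (N : nat) (x0 : 'I_N -> 'rV[R]_d)
    (x : 'I_N -> R -> 'rV[R]_d) : Prop := ParticleSolution {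
  ps_init : forall i, x i 0 = x0 i ;
  ps_continuous : forall i, {within `[0, +oo[, continuous (x i)} ;
  ps_ode : forall i (t : R), 0 < t ->
    is_derive t 1 (x i) (velocity V K (empirical (fun j => x j t)) (x i t)) }.

End matrix_svgd.

Section gaussian_conjugate.
Context {R : realType} {d : nat}.
Variable A : 'rV[R]_d -> 'rV[R]_d.

(* pi_A has density (2 pi)^(-d/2) exp (- VA); the flow sees pi_A only through
   the gradient of VA. *)
Definition VA (x : 'rV[R]_d) : R :=
  - ln (\det (Dmx A x)) + 2^-1 * enorm (A x) ^+ 2.

Definition KA1 (x x' : 'rV[R]_d) : 'M[R]_d :=
  invmx (Dmx A x) *m (invmx (Dmx A x'))^T.

End gaussian_conjugate.

Section random_vectors.
Context {R : realType} {d : nat} {disp : measure_display}.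
Context {Omega : measurableType disp}.
Variable P : probability Omega R.
Local Notation E := (borelRV R d).

Definition has_law (mu0 : probability E R) (X : {RV P >-> E}) : Prop :=
  forall B : set E, measurable B -> distribution P X B = mu0 B.

Definition mutually_independent (N : nat) (X : 'I_N -> {RV P >-> E}) : Prop :=
  forall (J : {set 'I_N}) (B : 'I_N -> set E), (forall i, measurable (B i)) ->
    P (\bigcap_(i in [set i | i \in J]) (X i @^-1` B i)) =
    (\prod_(i in J) P (X i @^-1` B i))%E.

Definition cov_mx (Y : Omega -> 'rV[R]_d) : 'M[R]_d :=
  \matrix_(a, b) fine (covariance P (fun w => Y w 0 a) (fun w => Y w 0 b)).

End random_vectors.

(* Main.v *)
From HB Require Import structures.
Require Import Defs.
From mathcomp Require Import all_boot all_order all_algebra perm.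
From mathcomp Require Import all_classical all_reals all_analysis.
From mathcomp Require Import measurable_realfun giry ring lra.

Set Implicit Arguments.
Unset Strict Implicit.
Unset Printing Implicit Defensive.

Import Order.TTheory GRing.Theory Num.Theory.
Import numFieldNormedType.Exports.

Local Open Scope classical_set_scope.
Local Open Scope ring_scope.

(* Piola's identity turns the drift into drift(x, y) = - DA(x)^-1 A(y): the
   divergence of the cofactors of DA vanishes since second derivatives commute.
   Hence, in the coordinates A, each flow translates all points at the common
   velocity - m, where m is the mean of A.  So m' = - m along the particle system
   (chain rule) and along the mean-field flow (weak formulation, tested against
   truncations of the coordinates of A), that is, m(t) = e^-t m(0).  The error
   at time t, or averaged over [0, T], is therefore a factor in [0, 1] times the
   initial error, which is the deviation of an empirical mean of i.i.d. vectors
   and has mean square Tr Cov(A(X(0))) / N. *)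

(** * Calculus: Schwarz, Jacobi and Piola *)

(** The laws [mu t] come with no moment assumption at positive times, and the weak equation only
    sees compactly supported C^1 functions. Integrability of A under [mu t] is recovered from the
    existence of the velocity: up to an invertible constant matrix, the drift at the single point 0
    is A(y). The test functions multiply theta(A_a) by a cutoff depending only on |A|^2 / (n+1)^2.
    Their derivative along the flow is paired with the position-independent vector - m, and the
    factor 1/(n+1)^2 offsets the growth of A on the support, so that a multiple of |m| dominates
    every flux. The function theta is kept general because it is used twice: the identity gives the
    equation of the mean, and sqrt(1 + u^2) gives the first-moment bound that allows space integrals
    and time averages to be exchanged. Since the error at every time is a deterministic multiple of
    one random vector, the suprema are bounded outcome by outcome by the initial error, whose mean
    square is computed exactly. *)

Lemma is_derive_line (R : numFieldType) (V W : normedModType R) (f : V -> W)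
    (x v : V) (t : R) :
  derivable f (x + t *: v) v ->
  is_derive t 1 (fun s => f (x + s *: v)) ('D_v f (x + t *: v)).
Proof.
have E : (fun h : R => h^-1 *: (((fun s => f (x + s *: v)) \o shift t) (h *: (1 : R)) -
      f (x + t *: v))) =
   (fun h : R => h^-1 *: ((f \o shift (x + t *: v)) (h *: v) - f (x + t *: v))).
  apply/funext => h /=; congr (_ *: (f _ - _)).
  by rewrite [h *: 1]mulr1 scalerDl addrCA.
move=> df; split; first by rewrite /derivable E.
by rewrite /derive E.
Qed.

Section second_derivatives.
Variables (R : realType) (V : normedModType R) (f : V -> R).

(** The mean value theorem is used twice, along [u] for the increment [g] and then along [v] for the
    derivative in [u]. The left-hand side is symmetric in [u] and [v], which is what makes the two
    orders of differentiation comparable. *)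
Lemma second_difference_mean_value (u v : V) (x : V) (h : R) : 0 < h ->
  (forall y, derivable f y u) -> (forall y, derivable ('D_u f) y v) ->
  exists s r, [/\ 0 < s < h, 0 < r < h &
    f (x + h *: u + h *: v) - f (x + h *: u) - f (x + h *: v) + f x =
    h ^+ 2 * 'D_v ('D_u f) (x + s *: u + r *: v)].
Proof.
move=> h0 du dv.
pose g s := f (x + h *: v + s *: u) - f (x + s *: u).
have dg s : is_derive s (1:R) g ('D_u f (x + h *: v + s *: u) - 'D_u f (x + s *: u)).
  by apply: is_deriveB; exact: is_derive_line.
have [s] := @MVT R g _ 0 h h0 (fun s _ => dg s)
  (derivable_within_continuous (fun s _ => @ex_derive _ _ _ _ _ _ _ (dg s))).
rewrite in_itv/= subr0 => s0h Eg.
have dk r : is_derive r (1:R) (fun r => 'D_u f (x + s *: u + r *: v))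
    ('D_v ('D_u f) (x + s *: u + r *: v)).
  exact: is_derive_line.
have [r] := @MVT R _ _ 0 h h0 (fun r _ => dk r)
  (derivable_within_continuous (fun s _ => @ex_derive _ _ _ _ _ _ _ (dk s))).
rewrite in_itv/= subr0 => r0h Ek.
exists s, r; split => //.
have -> : f (x + h *: u + h *: v) - f (x + h *: u) - f (x + h *: v) + f x =
   g h - g 0.
  by rewrite /g !scale0r !addr0 (addrAC x) opprB addrA [RHS]addrAC.
rewrite Eg.
have -> : x + h *: v + s *: u = x + s *: u + h *: v by rewrite addrAC.
rewrite scale0r addr0 in Ek.
by rewrite Ek -mulrA [LHS]mulrC expr2.
Qed.

(** Both mixed derivatives, each taken at some point close to [x], equal the same second difference
    divided by h^2. Continuity at [x] then brings each within e/2 of its value there. *)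
Lemma schwarz (u v x : V) :
  (forall y, derivable f y u) -> (forall y, derivable f y v) ->
  (forall y, derivable ('D_u f) y v) -> (forall y, derivable ('D_v f) y u) ->
  {for x, continuous ('D_v ('D_u f))} -> {for x, continuous ('D_u ('D_v f))} ->
  'D_v ('D_u f) x = 'D_u ('D_v f) x.
Proof.
move=> du dv duv dvu cuv cvu; apply/eqP; rewrite -subr_eq0 -normr_le0.
apply/ler_addgt0Pr => e e0; rewrite add0r.
have e2 : 0 < e / 2 by rewrite divr_gt0.
move/cvgrPdist_le : cuv => /(_ _ e2) /nbhs_ballP[r1 /= r10 H1].
move/cvgrPdist_le : cvu => /(_ _ e2) /nbhs_ballP[r2 /= r20 H2].
pose k := Num.min r1 r2.
have k0 : 0 < k by rewrite lt_min r10.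
(* The added 1 keeps [c] positive even if both directions vanish. With h = k / c, every point
   produced by the mean value theorem is within [k] of [x]. *)
pose c := `|u| + `|v| + 1.
have c0 : 0 < c by rewrite ltr_wpDl// addr_ge0.
pose h := k / c.
have h0 : 0 < h by rewrite divr_gt0.
have close s r : 0 < s < h -> 0 < r < h -> `|s *: u + r *: v| < k.
  move=> /andP[s0 sh] /andP[r0 rh]; rewrite (le_lt_trans (ler_normD _ _))//.
  rewrite !normrZ !gtr0_norm//.
  apply: (@le_lt_trans _ _ (h * (`|u| + `|v|))).
    by rewrite mulrDr lerD// ler_wpM2r// ltW.
  rewrite /h mulrAC ltr_pdivrMr// ltr_pM2l// /c.
  by rewrite ltrDl.
have [s [r [sh rh E1]]] := second_difference_mean_value x h0 du duv.
have [s' [r' [sh' rh' E2]]] := second_difference_mean_value x h0 dv dvu.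
have /H1 D1 : ball x r1 (x + s *: u + r *: v).
  rewrite -ball_normE/= -addrA opprD addNKr normrN.
  by apply: lt_le_trans (close _ _ sh rh) _; rewrite ge_min lexx.
have /H2 D2 : ball x r2 (x + s' *: v + r' *: u).
  rewrite -ball_normE/= -addrA opprD addNKr normrN addrC.
  by apply: lt_le_trans (close _ _ rh' sh') _; rewrite ge_min lexx orbT.
have hh : h ^+ 2 != 0 by rewrite expf_neq0// gt_eqF.
move: E1; rewrite (addrAC x) [X in X + f x]addrAC E2.
move=> {E2 close H1 H2} /(mulfI hh) E.
rewrite -(subrKA ('D_v ('D_u f) (x + s *: u + r *: v))).
apply: le_trans (ler_normD _ _) _; rewrite (splitr e); apply: lerD.
  exact: D1.
by rewrite -E distrC; exact: D2.
Qed.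

End second_derivatives.

Section derive_bigop.
Variables (R : realType) (V : normedModType R) (I : eqType).
Variables (F : I -> V -> R) (dF : I -> R) (x v : V).
Hypothesis FdF : forall i, is_derive x v (F i) (dF i).

Lemma is_derive_bigsum (r : seq I) :
  is_derive x v (fun y => \sum_(i <- r) F i y) (\sum_(i <- r) dF i).
Proof.
elim: r => [|a r IH].
  rewrite big_nil; under eq_fun do rewrite big_nil.
  exact: is_derive_cst.
rewrite big_cons; under eq_fun do rewrite big_cons.
exact: is_deriveD.
Qed.

Lemma is_derive_bigprod (r : seq I) : uniq r ->
  is_derive x v (fun y => \prod_(i <- r) F i y)
    (\sum_(i <- r) \prod_(j <- r) (if j == i then dF j else F j x)).
Proof.
elim: r => [_|a r IH /= /andP[ar ur]].
  rewrite big_nil; under eq_fun do rewrite big_nil.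
  exact: is_derive_cst.
rewrite big_cons; under eq_fun do rewrite big_cons.
refine (is_derive_eq (is_deriveM (FdF a) (IH ur)) _).
rewrite addrC; congr (_ + _).
  rewrite big_cons eqxx mulrC; congr (_ * _); apply: eq_big_seq => i ir.
  by case: eqP => // ia; rewrite -ia ir in ar.
rewrite scaler_sumr; apply: eq_big_seq => i ir; rewrite big_cons.
by case: eqP => // ia; rewrite ia ir in ar.
Qed.

End derive_bigop.

Section derive_matrix.
Variables (R : realType) (V : normedModType R) (x v : V).

(** Restriction to the line through [x] directed by [v] reduces this to the chain rule on R, so a
    directional derivative of [f] suffices. *)
Lemma is_derive_comp_real (f : V -> R) (g : R -> R) (df dg : R) :
  is_derive x v f df -> is_derive (f x) 1 g dg ->
  is_derive x v (fun y => g (f y)) (dg * df).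
Proof.
move=> fdf gdg.
have line (k : V -> R) : is_derive 0 (1 : R) (fun h => k (x + h *: v)) =
                         is_derive x v k.
  have E : (fun h : R => h^-1 *: (((fun s => k (x + s *: v)) \o shift 0) (h *: (1 : R)) -
      k (x + 0 *: v))) =
   (fun h : R => h^-1 *: ((k \o shift x) (h *: v) - k x)).
    apply/funext => h /=; congr (_ *: (k _ - k _)).
      by rewrite addr0 [h *: 1]mulr1 addrC.
    by rewrite scale0r addr0.
  apply/funext => d; apply/propext; split => -[].
    by rewrite /derivable /derive E.
  rewrite /derivable -E => dk dkE; split => //.
  by rewrite -dkE /derive -E.
rewrite -line; rewrite -line in fdf.
apply: (@is_derive1_comp R g (fun h => f (x + h *: v))) => //.
by rewrite scale0r addr0.
Qed.

(** Jacobi's formula. The product rule in the Leibniz expansion differentiates one row at a time;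
    [C i] is [B x] with row [i] taken from [dB], and expanding it along that row brings out the
    cofactors of [B x]. *)
Lemma is_derive_det (n : nat) (B : V -> 'M[R]_n) (dB : 'M[R]_n) :
  (forall i j, is_derive x v (fun y => B y i j) (dB i j)) ->
  is_derive x v (fun y => \det (B y)) (\tr (dB *m \adj (B x))).
Proof.
move=> BdB.
have /= D (s : 'S_n) : is_derive x v
   (fun y => (-1) ^+ s * \prod_i B y i (s i))
   ((-1) ^+ s * \sum_i \prod_j (if j == i then dB j (s j) else B x j (s j))).
  have P := is_derive_bigprod (fun i => BdB i (s i)) (index_enum_uniq 'I_n).
  refine (is_derive_eq (is_deriveM (is_derive_cst ((-1) ^+ s : R) x v) P) _).
  by rewrite scaler0 addr0.
refine (is_derive_eq (is_derive_bigsum D _) _).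
pose C i := \matrix_(j, k) (if j == i then dB j k else B x j k).
transitivity (\sum_i \det (C i)).
  rewrite /determinant exchange_big/=; apply: eq_bigr => s _.
  rewrite mulr_sumr; apply: eq_bigr => i _; congr (_ * _).
  by apply: eq_bigr => j _; rewrite mxE.
apply: eq_bigr => i _; rewrite mxE (expand_det_row _ i); apply: eq_bigr => j _.
rewrite !mxE eqxx; congr (_ * (_ * \det _)); apply/matrixP => k l.
by rewrite !mxE eq_sym (negbTE (neq_lift _ _)).
Qed.

Lemma is_derive_mulmx (m n p : nat) (B : V -> 'M[R]_(m, n)) (C : V -> 'M[R]_(n, p))
    (dB : 'M[R]_(m, n)) (dC : 'M[R]_(n, p)) :
  (forall i j, is_derive x v (fun y => B y i j) (dB i j)) ->
  (forall i j, is_derive x v (fun y => C y i j) (dC i j)) ->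
  forall i j, is_derive x v (fun y => (B y *m C y) i j)
    ((dB *m C x + B x *m dC) i j).
Proof.
move=> BdB CdC i j; under eq_fun do rewrite mxE.
refine (is_derive_eq
  (is_derive_bigsum (fun k => is_deriveM (BdB i k) (CdC k j)) _) _).
rewrite !mxE -big_split/=; apply: eq_bigr => k _.
rewrite addrC; congr (_ + _); exact: mulrC.
Qed.

(** Cramer's rule shows that the entries of the inverse are derivable; differentiating the identity
    B^-1 B = 1 then gives the value of the derivative. *)
Lemma is_derive_invmx (n : nat) (B : V -> 'M[R]_n) (dB : 'M[R]_n) :
  (forall y, B y \in unitmx) ->
  (forall i j, is_derive x v (fun y => B y i j) (dB i j)) ->
  forall i j, is_derive x v (fun y => invmx (B y) i j)
    ((- (invmx (B x) *m dB *m invmx (B x))) i j).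
Proof.
move=> uB BdB i j.
have dM k l : derivable (fun y => invmx (B y) k l) x v.
  have -> : (fun y => invmx (B y) k l) =
      (fun y => (\det (B y))^-1) * (fun y => cofactor (B y) l k).
    by apply/funext => y; rewrite /invmx uB !mxE.
  apply: derivableM.
    apply: derivableV.
      by have := uB x; rewrite unitmxE unitfE.
    by have [] := is_derive_det BdB.
  apply: derivableM; first exact: derivable_cst.
  have dBkl i' j' : is_derive x v (fun y => row' l (col' k (B y)) i' j')
      (row' l (col' k dB) i' j').
    by rewrite !mxE; under eq_fun do rewrite !mxE; exact: BdB.
  by have [] := is_derive_det dBkl.
pose D := \matrix_(k, l) 'D_v (fun y => invmx (B y) k l) x.
have MD k l : is_derive x v (fun y => invmx (B y) k l) (D k l).
  by rewrite mxE; exact: derivableP.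
have DB0 : D *m B x + invmx (B x) *m dB = 0.
  apply/matrixP => k l.
  have [_ <-] := is_derive_mulmx MD BdB k l.
  have -> : (fun y => (invmx (B y) *m B y) k l) = cst ((1%:M : 'M[R]_n) k l).
    by apply/funext => y; rewrite mulVmx.
  by rewrite derive_cst mxE.
suff <- : D = - (invmx (B x) *m dB *m invmx (B x)) by [].
move/eqP: DB0; rewrite addr_eq0 => /eqP /(congr1 (mulmx^~ (invmx (B x)))).
by rewrite mulmxK// mulNmx.
Qed.

End derive_matrix.

Section piola.
Variables (R : realType) (d : nat).
Implicit Types (A : 'rV[R]_d -> 'rV[R]_d) (x y : 'rV[R]_d).

Lemma differentiable_rV A x :
  (forall a, differentiable (fun y => A y 0 a) x) -> differentiable A x.
Proof.
move=> dA.
have -> : A = \sum_(a < d) (fun y => A y 0 a *: (delta_mx 0 a : 'rV[R]_d)).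
  apply/funext => y; rewrite fct_sumE; exact: row_sum_delta.
by apply: differentiable_sum => a; exact: differentiableZl.
Qed.

Lemma Ck_map_differentiable k A x : Ck_map k.+1 A -> differentiable A x.
Proof. by move=> CA; apply: differentiable_rV => a; have [] := CA a. Qed.

Lemma DmxE k A x a b : Ck_map k.+1 A ->
  Dmx A x a b = partial b (fun y => A y 0 a) x.
Proof.
move=> CA; have dA := Ck_map_differentiable x CA.
rewrite /Dmx mxE /jacobian mxE -deriveE// derive_mx; last exact: diff_derivable.
by rewrite mxE.
Qed.

Lemma Ck_partial_derive (k : nat) (f : 'rV[R]_d -> R) b x : Ck k.+1 f ->
  is_derive x (delta_mx 0 b) f (partial b f x).
Proof. by move=> [df _]; apply: derivableP; exact: diff_derivable. Qed.

Lemma Ck_schwarz (f : 'rV[R]_d -> R) a b x : Ck 2 f ->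
  partial b (partial a f) x = partial a (partial b f) x.
Proof.
move=> [df Cf]; apply: schwarz => [y|y|y|y||].
- exact/diff_derivable/df.
- exact/diff_derivable/df.
- by apply: diff_derivable; have [+ _] := Cf a; apply.
- by apply: diff_derivable; have [+ _] := Cf b; apply.
- by have [_ /(_ b)] := Cf a; apply.
- by have [_ /(_ a)] := Cf b; apply.
Qed.

Variable A : 'rV[R]_d -> 'rV[R]_d.
Hypothesis A3 : Ck_map 3 A.
Hypothesis detA : forall x, 0 < \det (Dmx A x).

Lemma Dmx_unit x : Dmx A x \in unitmx.
Proof. by rewrite unitmxE unitfE gt_eqF. Qed.

Let dDmx b x : 'M[R]_d :=
  \matrix_(i, j) partial b (partial j (fun y => A y 0 i)) x.

Let dDmxE b x i j :
  dDmx b x i j = partial b (partial j (fun y => A y 0 i)) x.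
Proof. by rewrite mxE. Qed.

Let is_derive_Dmx b x i j :
  is_derive x (delta_mx 0 b) (fun y => Dmx A y i j) (dDmx b x i j).
Proof.
rewrite dDmxE; under eq_fun do rewrite (DmxE _ _ _ A3).
by apply: (@Ck_partial_derive 1); have [_] := A3 i; apply.
Qed.

(** By Jacobi's formula the logarithmic derivative of det DA is a trace against adj / det, that is,
    against the inverse. The factor 1/2 absorbs the 2 coming from the squared norm. *)
Let grad_VA x b :
  grad (VA A) x 0 b =
  - \tr (dDmx b x *m invmx (Dmx A x)) + (A x *m Dmx A x) 0 b.
Proof.
rewrite mxE /partial; apply: derive_val.
have D1 := is_derive_comp_real (is_derive_det (is_derive_Dmx b x))
  (is_derive1_ln (detA x)).
have Da a : is_derive x (delta_mx 0 b) (fun y => A y 0 a) (Dmx A x a b).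
  by rewrite (DmxE _ _ _ A3); exact: (@Ck_partial_derive 2).
have D2 := is_derive_bigsum (fun a => is_deriveM (Da a) (Da a)) (index_enum 'I_d).
have -> : VA A = (- (fun y => ln (\det (Dmx A y)))) +
   (cst (2^-1 : R) * (fun y => \sum_(a < d) A y 0 a * A y 0 a)).
  apply/funext => y; rewrite /VA /enorm sqr_sqrtr ?sumr_ge0//.
  by move=> a _; rewrite sqr_ge0.
refine (is_derive_eq (is_deriveD (is_deriveN D1)
  (is_deriveM (is_derive_cst (2^-1 : R) x (delta_mx 0 b)) D2)) _).
congr (- _ + _).
  rewrite /invmx Dmx_unit -scalemxAr linearZ//.
rewrite scaler0 addr0 mxE scaler_sumr; apply: eq_bigr => a _.
rewrite /cst /GRing.scale/=; lra.
Qed.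

(** The factor of the kernel at [x] is constant for the divergence in [y] and is pulled out on the
    right. *)
Let div2_KA1 x y : div2 (KA1 A) x y =
  (\row_c \sum_b (- (invmx (Dmx A y) *m dDmx b y *m invmx (Dmx A y))) b c)
    *m (invmx (Dmx A x))^T.
Proof.
apply/rowP => a; rewrite !mxE.
transitivity (\sum_b \sum_c invmx (Dmx A x) a c *
   (- (invmx (Dmx A y) *m dDmx b y *m invmx (Dmx A y))) b c); last first.
  rewrite exchange_big/=; apply: eq_bigr => c _.
  by rewrite !mxE mulr_suml; apply: eq_bigr => b _; rewrite mulrC.
apply: eq_bigr => b _; apply: derive_val.
have D := is_derive_invmx Dmx_unit (is_derive_Dmx b y).
have -> : (fun z => KA1 A x z a b) =
   (fun z => \sum_c cst (invmx (Dmx A x) a c) z * invmx (Dmx A z) b c).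
  by apply/funext => z; rewrite /KA1 mxE; apply: eq_bigr => c _; rewrite !mxE.
refine (is_derive_eq (is_derive_bigsum (fun c => is_deriveM
  (is_derive_cst (invmx (Dmx A x) a c) y (delta_mx 0 b)) (D b c)) _) _).
by apply: eq_bigr => c _; rewrite scaler0 addr0.
Qed.

(** With M = DA^-1, the right side minus the left side is the sum over b of the b-derivative of
    det(DA) M_bc, divided by det(DA): the divergence of the cofactors. Both sides expand to the same
    triple sum except for the order of two partial derivatives of A_i. *)
Lemma piola x c :
  \sum_b (invmx (Dmx A x) *m dDmx b x *m invmx (Dmx A x)) b c =
  \sum_b \tr (dDmx b x *m invmx (Dmx A x)) * invmx (Dmx A x) b c.
Proof.
move: (invmx (Dmx A x)) => M.
transitivity (\sum_b \sum_j \sum_i M b i * dDmx b x i j * M j c).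
  apply: eq_bigr => b _; rewrite mxE; apply: eq_bigr => j _.
  by rewrite mxE mulr_suml.
rewrite exchange_big/=; apply: eq_bigr => j _.
have C2 i : Ck 2 (fun y => A y 0 i).
  have [dA CA] := A3 i; split => // b; have [dA' CA'] := CA b.
  split => // b'; have := CA' b'; case=> + _ => dA'' y.
  exact/differentiable_continuous/dA''.
rewrite /mxtrace mulr_suml exchange_big/=; apply: eq_bigr => i _.
rewrite mxE mulr_suml; apply: eq_bigr => b _; congr (_ * _).
rewrite mulrC; congr (_ * _).
exact: etrans (dDmxE b x i j)
  (etrans (Ck_schwarz _ _ _ (C2 i)) (esym (dDmxE j x i b))).
Qed.

(** The trace vector from the gradient of - log det DA cancels the divergence of the kernel, by
    Piola's identity. The quadratic part of the potential contributes A(y) DA(y), whose second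
    factor is undone by the kernel. *)
Lemma drift_conjugate x y :
  drift (VA A) (KA1 A) x y = - (A y *m (invmx (Dmx A x))^T).
Proof.
rewrite /drift; have -> : grad (VA A) y =
    - (\row_b \tr (dDmx b y *m invmx (Dmx A y))) + A y *m Dmx A y.
  by apply/rowP => b; rewrite grad_VA !mxE.
rewrite div2_KA1 /KA1 trmx_mul trmxK mulmxA -mulNmx -mulmxDl -[RHS]mulNmx.
congr (_ *m _); rewrite mulmxDl mulmxK ?Dmx_unit// opprD -addrA addrC -addrA.
rewrite -[RHS]addr0; congr (_ + _); rewrite mulNmx opprK.
apply/rowP => c; rewrite !mxE; under eq_bigr do rewrite mxE.
rewrite sumrN piola addrC; apply/eqP; rewrite subr_eq0; apply/eqP.
by apply: eq_bigr => b _; rewrite mxE.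
Qed.

End piola.

(** * Integrals against empirical measures and time averages *)

Section set_function_integral.
Context d (T : measurableType d) (R : realType).
Import HBNNSimple.
Local Open Scope ereal_scope.

(* [time_average] is a mere set function, uncontrolled off the measurable sets. *)
Lemma eq_set_function_integral (m1 m2 : set T -> \bar R) (f : T -> \bar R) :
  (forall B, measurable B -> m1 B = m2 B) ->
  \int[m1]_x f x = \int[m2]_x f x.
Proof.
move=> m12; have E (h : {nnsfun T >-> R}) : sintegral m1 h = sintegral m2 h.
  by apply: eq_fsbigr => r _; rewrite m12.
by rewrite /integral; congr (ereal_sup _ - ereal_sup _);
  apply: eq_imagel => h _; exact: E.
Qed.

(* A supremum over uncountably many times need not be measurable. *)
Lemma le_integral_nonmeasurable (mu : {measure set T -> \bar R})
    (f g : T -> \bar R) : (forall x, 0 <= f x) -> (forall x, f x <= g x) ->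
  \int[mu]_x f x <= \int[mu]_x g x.
Proof.
move=> f0 fg; have g0 x : 0 <= g x by exact: le_trans (fg x).
rewrite !ge0_integralTE//; apply: ge_ereal_sup => _ [h hf <-].
by apply: ereal_sup_ubound; exists h => // x; exact: le_trans (fg x).
Qed.

End set_function_integral.

(** The approximation is min(1, n dist(x, complement of U)): it is zero off [U], and on [U] it is
    eventually 1 because the distance is positive there. *)
Lemma open_indicator_limit (R : realType) (V : normedModType R) (U : set V) :
  open U -> exists h : nat -> V -> R, [/\ forall n, continuous (h n),
    forall n x, 0 <= h n x <= 1 & forall x, h ^~ x @ \oo --> (\1_U x : R)].
Proof.
(* The whole space is treated apart: the distance to the empty set is infinite, and [fine] would
   send it to 0. *)
move=> oU; have [UT|/set0P[a0 Ua0]] := eqVneq (~` U) set0.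
  exists (fun _ _ => 1); split => [n|n x|x].
  - exact: cst_continuous.
  - by rewrite ler01 lexx.
  - by rewrite -(setCK U) UT setC0 indicT; exact: cvg_cst.
pose g x := fine (edist_inf (~` U) x).
have gfin x : edist_inf (~` U) x \is a fin_num.
  rewrite ge0_fin_numE ?edist_inf_ge0//; apply: le_lt_trans.
    by apply: ereal_inf_lbound; exists a0.
  rewrite -ge0_fin_numE ?edist_ge0//; apply/edist_finP.
  exists (`|x - a0| + 1); first by rewrite ltr_wpDl.
  by rewrite /= -ball_normE/= ltrDl.
have g0 x : 0 <= g x by rewrite fine_ge0// edist_inf_ge0.
have gc : continuous g.
  move=> x; apply: fine_cvg; rewrite fineK//; exact: edist_inf_continuous.
exists (fun n x => Num.min 1 (n%:R * g x)); split => [n x|n x|x].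
- apply: (@continuous_min R V (cst 1) (fun y => n%:R * g y)); first exact: cvg_cst.
  by apply: continuousM; [exact: cvg_cst|exact: gc].
- by rewrite le_min ler01 mulr_ge0//= ge_min lexx.
have [Ux|nUx] := pselect (U x); last first.
  rewrite indicE memNset// /g edist_inf0//=.
  by under eq_fun do rewrite mulr0 (min_idPr _)//; exact: cvg_cst.
rewrite indicE mem_set//.
have gx0 : 0 < g x.
  have [e /= e0 eU] : nbhs_ball x U by apply/nbhs_ballP; exact: open_nbhs_nbhs.
  rewrite -lte_fin fineK// (@lt_le_trans _ _ e%:E)//.
  apply: le_ereal_inf_tmp => _ [a Ua <-]; rewrite leNgt; apply/negP => ae.
  have [r /andP[r0 re] xar] : exists2 r, 0 < r < e & ball x r a.
    have afin : edist (x, a) \is a fin_num.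
      by rewrite ge0_fin_numE ?edist_ge0// (lt_trans ae)// ltry.
    exists ((fine (edist (x, a)) + e) / 2).
      have : fine (edist (x, a)) < e by rewrite -lte_fin fineK.
      have : 0 <= fine (edist (x, a)) by rewrite fine_ge0// edist_ge0.
      by move=> *; apply/andP; split; lra.
    apply: (@edist_lt_ball _ _ _ (x, a)).
    rewrite -(fineK afin) lte_fin.
    have : fine (edist (x, a)) < e by rewrite -lte_fin fineK.
    by move=> ?; lra.
  by apply: Ua; apply: eU; apply: le_ball xar; exact: ltW.
apply: cvg_near_cst; near=> n.
apply/min_idPl; rewrite -ler_pdivrMr//.
near: n; exact: nbhs_infty_ger.
Unshelve. all: by end_near. Qed.

Section borel.
Context {R : realType} {d : nat}.
Local Notation E := (borelRV R d).

Lemma continuous_measurable_borel (f : 'rV[R]_d -> R) :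
  continuous f -> measurable_fun setT (f : E -> R).
Proof.
move=> /continuousP cf; apply: (measurability _ (RGenOpens.measurableE R)).
move=> _ [_ [a [b ->] <-]]; rewrite setTI; apply: sub_sigma_algebra.
exact/cf/interval_open.
Qed.

(** Positive and negative parts are integrated separately; both integrals are finite sums of reals,
    so their difference is well defined for every measurable [f]. *)
Lemma integral_empirical (N : nat) (x : 'I_N -> E) (f : E -> R) :
  measurable_fun setT f ->
  (\int[empirical x]_y (f y)%:E = (N%:R^-1 * \sum_(i < N) f (x i))%:E)%E.
Proof.
move=> mf.
(* [msum] is indexed by the natural numbers, hence the extension of the Dirac masses by the null
   measure beyond [N]. *)
pose m (k : nat) : {measure set E -> \bar R} :=
  if insub k is Some i then \d_(x i) else mzero.
pose c : {nonneg R} := NngNum (ltac:(by rewrite invr_ge0) : 0 <= N%:R^-1 :> R).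
rewrite (@eq_set_function_integral _ _ _ _ (mscale c (msum m N))); last first.
  move=> B _; rewrite /empirical /mscale /msum /=.
  by congr (_ * _)%E; apply: eq_bigr => i _; rewrite /m valK.
have ge0 (g : E -> \bar R) : measurable_fun setT g -> (forall y, 0 <= g y)%E ->
    (\int[mscale c (msum m N)]_y g y =
     N%:R^-1%:E * \sum_(i < N) g (x i))%E.
  move=> mg g0; rewrite ge0_integral_mscale//; congr (_ * _)%E.
  rewrite ge0_integral_measure_sum//; apply: eq_bigr => i _.
  by rewrite /m valK integral_dirac// diracT mul1e.
have mfe : measurable_fun setT (EFin \o f) by exact/measurable_EFinP.
rewrite integralE ge0//; last exact: measurable_funepos.
rewrite ge0//; last exact: measurable_funeneg.
have -> : (\sum_(i < N) (fun y => (f y)%:E)^\+ (x i) =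
    (\sum_(i < N) f^\+%R (x i))%:E)%E.
  by rewrite -sumEFin; apply: eq_bigr => i _; rewrite funeposE/= -EFin_max.
have -> : (\sum_(i < N) (fun y => (f y)%:E)^\- (x i) =
    (\sum_(i < N) f^\-%R (x i))%:E)%E.
  by rewrite -sumEFin; apply: eq_bigr => i _; rewrite funenegE/= -EFin_max.
rewrite -!EFinM -EFinB -mulrBr -sumrB; congr (_ * _)%:E.
by apply: eq_bigr => i _; rewrite -[in RHS](funrposBneg f).
Qed.

Lemma vint_empirical (N : nat) (x : 'I_N -> E) (f : E -> 'rV[R]_d) :
  (forall a, measurable_fun setT (fun y => f y 0 a)) ->
  vint (empirical x) f = N%:R^-1 *: \sum_(i < N) f (x i).
Proof.
move=> mf; apply/rowP => a.
by rewrite !mxE integral_empirical//= summxE.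
Qed.

(** The mass is 0 when [N] is 0, hence an inequality. As sub-probabilities, empirical measures are
    points of [giry], where the mean-field laws can be placed as well. *)
Lemma empirical_setT_le1 (N : nat) (x : 'I_N -> E) :
  (empirical x setT <= 1)%E.
Proof.
rewrite /empirical (eq_bigr (fun=> 1%E)); last by move=> i _; rewrite diracT.
rewrite sumEFin sumr_const card_ord -EFinM lee_fin.
case: N x => [|N] x; first by rewrite mulr0n mulr0.
by rewrite mulVf// pnatr_eq0.
Qed.

HB.instance Definition _ (N : nat) (x : 'I_N -> E) :=
  Measure_isSubProbability.Build _ _ _ (empirical x) (empirical_setT_le1 x).

End borel.

Section time_average.
Context {R : realType} {d : nat}.
Local Notation E := (borelRV R d).
Variable nu : R -> giry E R.
Hypothesis nu_narrow : forall f : 'rV[R]_d -> R, continuous f ->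
  (exists C : R, forall x, `|f x| <= C) ->
  {within `[0, +oo[, continuous (fun t => \int[nu t]_x f x)}.

Lemma bounded_continuous_integrable (m : giry E R) (f : 'rV[R]_d -> R) (C : R) :
  continuous f -> (forall x, `|f x| <= C) ->
  m.-integrable setT (fun x : E => (f x)%:E).
Proof.
move=> fc fC; apply: (@measurable_bounded_integrable _ _ R m f setT) => //.
- by rewrite (le_lt_trans sprobability_setT)// ltry.
- exact: continuous_measurable_borel.
- exists C; split; first exact: num_real.
  by move=> M CM x _; apply: le_trans (fC x) (ltW CM).
Qed.

(** For [B] open, the mass is a pointwise limit of integrals of bounded continuous functions, each
    continuous in time by narrow continuity. Open sets form a pi-system generating the Borel sets,
    and the Dynkin argument extends measurability to all of them. *)
Lemma measurable_narrow (B : set E) : measurable B ->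
  measurable_fun `[(0 : R), +oo[ (fun t => nu t B).
Proof.
have mD := @measurable_itv R `[0, +oo[.
have mopen (U : set 'rV[R]_d) : open U ->
    measurable_fun `[(0 : R), +oo[ (fun t => nu t (U : set E)).
  move=> oU; have [h [hc h01 hU]] := open_indicator_limit oU.
  have h1 n x : `|h n x| <= 1.
    by have /andP[h0 h1] := h01 n x; rewrite ger0_norm.
  have mU : measurable (U : set E) by exact: sub_sigma_algebra.
  apply: (emeasurable_fun_cvg (fun n t => \int[nu t]_x (h n x)%:E)%E) => [n|t _].
    apply: (eq_measurable_fun (fun t => (\int[nu t]_x h n x)%:E)).
      move=> t _; rewrite /Rintegral fineK//.
      apply: integrable_fin_num => //.
      exact: bounded_continuous_integrable (hc n) (h1 n).
    apply/measurable_EFinP; apply: subspace_continuous_measurable_fun => //.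
    by apply: nu_narrow => //; exists 1.
  have := @dominated_cvg _ E R (nu t) setT measurableT
    (fun n x => (h n x)%:E) (fun x => (\1_U x)%:E) (cst 1%E).
  rewrite integral_indic// setIT; apply => //.
  - by move=> n; apply/measurable_EFinP; exact: continuous_measurable_borel (hc n).
  - by move=> x _; apply: cvg_EFin; [by apply: nearW|exact: hU].
  - by apply: finite_measure_integrable_cst.
  - by move=> n x _; rewrite lee_fin.
move=> mB; apply: (@dynkin_induction _ E (@open 'rV[R]_d)
  [set B | measurable_fun `[(0 : R), +oo[ (fun t => nu t B)]) => //.
- by move=> U V; exact: openI.
- by apply: mopen; exact: openT.
- move=> S mS mnuS /=; rewrite [X in measurable_fun _ X](_ : _ =
      (fun t => nu t setT - nu t S)%E); last first.
    apply/funext => t; rewrite -setTD measureD//; first by rewrite setTI.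
    by rewrite -ge0_fin_numE// fin_num_measure.
  by apply: emeasurable_funB => //; apply: mopen; exact: openT.
- move=> F mF tF mnuF /=.
  apply: (emeasurable_fun_cvg (fun n t => \sum_(0 <= i < n) nu t (F i))%E) => [n|t _].
    exact: emeasurable_sum.
  exact: measure_semi_sigma_additive (bigcup_measurable _).
Qed.

(** On measurable sets the time average is the law obtained by drawing t uniformly in [0, T] and
    then a point from [nu t]: a bind in the Giry monad, whose integration formula is the required
    Fubini identity. *)
Lemma time_average_measure (T : R) : 0 < T ->
  exists2 m : giry E R, forall B, measurable B -> time_average T nu B = m B &
  forall h : E -> \bar R, measurable_fun setT h -> (forall x, 0 <= h x)%E ->
  (\int[m]_x h x =
   T^-1%:E * \int[lebesgue_measure]_(t in `[0%R, T]) \int[nu t]_x h x)%E.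
Proof.
move=> T0.
(* [nu] is arbitrary at negative times. *)
pose nu' (t : R) := nu (Num.max t 0).
have mnu' : measurable_fun setT nu'.
  apply: measurable_giry_codensity => // B mB.
  have := measurable_comp (@measurable_itv R `[0, +oo[) _ (measurable_narrow mB)
    (@measurable_maxr _ R R setT idfun (cst 0) _ _).
  apply => //; last exact: measurable_id.
  by move=> _ [t _ <-]; rewrite /= in_itv/= andbT le_max lexx orbT.
have nuE t : `[0%R, T]%classic t -> nu' t = nu t.
  by rewrite /= in_itv/= => /andP[t0 _]; rewrite /nu' max_l.
pose m : giry E R := giry_bind (uniform_prob T0) mnu'.
have Em g : measurable_fun setT g -> (forall x, 0 <= g x)%E ->
    (\int[m]_x g x =
     T^-1%:E * \int[lebesgue_measure]_(t in `[0%R, T]) \int[nu t]_x g x)%E.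
  move=> mg g0; have := giry_int_bind (uniform_prob T0) mnu' mg g0.
  rewrite /giry_int => ->; rewrite integral_uniform.
  - rewrite subr0; congr (_ * _)%E; apply: eq_integral => t.
    by rewrite inE => /nuE ->.
  - exact: (measurableT_comp (measurable_giry_int mg g0) mnu').
  - by move=> t; exact: integral_ge0.
exists m => // B mB.
rewrite -[RHS]/(m B) -(setIT B) -(@integral_indic _ E R m setT)// Em//.
- rewrite /time_average; congr (_ * _)%E; apply: eq_integral => t _.
  by rewrite integral_indic// !setIT.
- exact/measurable_EFinP.
Qed.

(** The identity for nonnegative functions is applied to the positive and negative parts. The bound
    [C] makes both time integrals finite, so they can be subtracted. *)
Lemma integral_time_average (T C : R) (f : E -> R) : 0 < T ->
  measurable_fun setT f ->
  (forall t, 0 <= t <= T -> (\int[nu t]_x `|f x|%R%:E <= C%:E)%E) ->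
  fine (\int[time_average T nu]_x (f x)%:E)%E =
  T^-1 * \int[lebesgue_measure]_(t in `[0, T]) \int[nu t]_x f x.
Proof.
move=> T0 mf fC.
have mfe : measurable_fun setT (EFin \o f) by exact/measurable_EFinP.
have intf t : `[0, T]%classic t -> (nu t).-integrable setT (EFin \o f).
  move=> tT; apply/integrableP; split => //.
  by rewrite (le_lt_trans (fC _ _))// ltry.
pose I g t := (\int[nu t]_x g x)%E.
have mI g : measurable_fun setT g -> (forall x, 0 <= g x)%E ->
    measurable_fun `[(0 : R), T] (I g).
  move=> mg g0.
  suff : measurable_fun `[(0 : R), +oo[ (I g).
    apply: measurable_funS => // t /=; rewrite !in_itv/= andbT.
    by case/andP.
  apply: (measurableT_comp (measurable_giry_int mg g0)).
  apply: measurable_giry_codensity => // B mB.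
  exact: measurable_narrow.
have iI g : measurable_fun setT g -> (forall x, 0 <= g x)%E ->
    (forall x, g x <= `|f x|%R%:E)%E ->
    lebesgue_measure.-integrable `[0, T] (I g).
  move=> mg g0 gf; apply/integrableP; split; first exact: mI.
  apply: (@le_lt_trans _ _ (\int[lebesgue_measure]_(t in `[0%R, T]) C%:E)%E).
    apply: ge0_le_integral => //.
    - by apply: measurableT_comp => //; exact: mI.
    - move=> t tT; rewrite gee0_abs ?integral_ge0//.
      apply: (le_trans _ (fC t _)); last by move: tT; rewrite /= in_itv.
      apply: ge0_le_integral => //.
      exact/measurable_EFinP/measurableT_comp.
  rewrite integral_cst//= lebesgue_measure_itv/= lte_fin T0 -EFinD -EFinM.
  exact: ltry.
pose fp := ((EFin \o f)^\+)%E; pose fn := ((EFin \o f)^\-)%E.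
have mfp : measurable_fun setT fp by exact: measurable_funepos.
have mfn : measurable_fun setT fn by exact: measurable_funeneg.
have fp0 x : (0 <= fp x)%E by exact: funepos_ge0.
have fn0 x : (0 <= fn x)%E by exact: funeneg_ge0.
have absE x : (`|f x|%R%:E = fp x + fn x)%E.
  by rewrite /fp /fn -[LHS]/((abse \o (EFin \o f)) x) fune_abse.
have ip : lebesgue_measure.-integrable `[0, T] (I fp).
  by apply: iI => // x; rewrite absE leeDl.
have in' : lebesgue_measure.-integrable `[0, T] (I fn).
  by apply: iI => // x; rewrite absE leeDr.
have [m mE intm] := time_average_measure T0.
rewrite (eq_set_function_integral _ mE) integralE !intm//.
have finp : (\int[lebesgue_measure]_(t in `[0%R, T]) I fp t)%E \is a fin_num.
  by apply: integrable_fin_num.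
have finn : (\int[lebesgue_measure]_(t in `[0%R, T]) I fn t)%E \is a fin_num.
  by apply: integrable_fin_num.
rewrite fineB ?fin_numM// !fineM// -mulrBr; congr (_ * _).
rewrite -fineB// -integralB//; congr fine; apply: eq_integral => t.
rewrite inE => tT; rewrite /Rintegral fineK; last first.
  by apply: integrable_fin_num => //; exact: intf.
by rewrite [RHS]integralE.
Qed.

End time_average.

(** * Exponential decay *)

Section exponential_decay.
Variable R : realType.
Local Notation mu := lebesgue_measure.

(** The product e^t u(t) has zero derivative, so it takes the same value at both ends. *)
Lemma ode_exponential_decay (u : R -> R) (b : R) : 0 < b ->
  {within `[0, b], continuous u} ->
  (forall t, 0 < t < b -> is_derive t 1 u (- u t)) ->
  u b = expR (- b) * u 0.
Proof.
move=> b0 uc du.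
have dv t : t \in `]0, b[ -> is_derive t (1 : R) (expR * u) 0.
  rewrite in_itv/= => /du ut.
  refine (is_derive_eq (is_deriveM (is_derive_expR t) ut) _).
  by rewrite scalerN -[u t *: _]/(u t * _) mulrC addNr.
have vc : {within `[0, b], continuous (expR * u)}.
  move=> x; apply: continuousM; last exact: uc.
  exact/continuous_subspaceT/continuous_expR.
have [c _] := MVT b0 dv vc.
rewrite mul0r => /eqP; rewrite subr_eq0 => /eqP E.
have : expR b * u b = expR 0 * u 0 by exact: E.
by rewrite expR0 mul1r => <-; rewrite mulrA -expRD addNr expR0 mul1r.
Qed.

(** Regularity is bootstrapped: the integral equation makes [u] continuous, the fundamental theorem
    of calculus then makes it differentiable, and the differential equation u' = - u can be
    solved. *)
Lemma volterra_exponential_decay (u : R -> R) :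
  (forall t, 0 <= t -> mu.-integrable `[0, t] (EFin \o u)) ->
  (forall t, 0 <= t -> u t = u 0 - \int[mu]_(s in `[0, t]) u s) ->
  forall t, 0 <= t -> u t = expR (- t) * u 0.
Proof.
move=> ui ue t; rewrite le_eqVlt => /predU1P[<-|t0].
  by rewrite oppr0 expR0 mul1r.
have uc b : 0 <= b -> {within `[0, b], continuous u}.
  move=> b0.
  have : {within `[0, b], continuous ((cst (u 0) : R -> R) -
      (fun s : R => parameterized_integral mu 0 s u))}.
    move=> s; apply: continuousB _; first exact: cst_continuous.
    exact: (parameterized_integral_continuous b0 (ui _ b0)).
  apply: subspace_eq_continuous => s; rewrite inE/= in_itv/= => /andP[s0 _].
  by rewrite [RHS]ue.
apply: ode_exponential_decay => //; first by apply: uc; exact: ltW.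
move=> s /andP[s0 st].
have sc : {for s, continuous u}.
  have := uc _ (ltW t0); rewrite continuous_within_itvP// => -[+ _ _].
  by apply; rewrite in_itv/= s0.
have [dF F's] := continuous_FTC1_closed st (ui _ (ltW t0)) s0 sc.
have D : is_derive s (1 : R) (cst (u 0) - (fun x => \int[mu]_(r in `[0, x]) u r)) (- u s).
  have dI : is_derive s (1 : R) (fun x => \int[mu]_(r in `[0, x]) u r) (u s).
    by split; [exact: dF|rewrite -derive1E; exact: F's].
  exact: is_derive_eq (is_deriveB (is_derive_cst (u 0) s (1 : R)) dI) (sub0r _).
(* The integral equation holds at nonnegative times only, which is enough near a positive [s]. *)
apply: near_eq_is_derive D.
near=> r; rewrite [RHS]ue//.
by apply: ltW; near: r; exact: lt_nbhsr.
Unshelve. all: by end_near. Qed.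

End exponential_decay.

(** * Truncated test functions *)

Section squared_positive_part.
Variable R : realType.

(** The difference quotient is within C|h| of [l]. This form treats the junction point of a
    piecewise quadratic function without one-sided derivatives. *)
Lemma is_derive_quadratic_remainder (f : R -> R) (x l C : R) :
  (forall h, `|f (h + x) - f x - h * l| <= C * h ^+ 2) ->
  is_derive x 1 f l.
Proof.
move=> fC; have C1 : 0 < `|C| + 1 by rewrite ltr_wpDl.
have lim : (fun h : R => h^-1 *: ((f \o shift x) (h *: (1 : R)) - f x)) @ 0^' --> l.
  apply/cvgrPdist_le => e e0; near=> h.
  have h0 : h != 0 by near: h; exact: nbhs_dnbhs_neq.
  have hn0 : 0 < `|h| by rewrite normr_gt0.
  rewrite /= [h *: 1]mulr1 -[_ *: _]/(h^-1 * _).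
  have -> : l - h^-1 * (f (h + x) - f x) = - (h^-1 * (f (h + x) - f x - h * l)).
    by rewrite [X in _ = - X]mulrBr mulKf// opprB.
  rewrite normrN normrM normfV ler_pdivrMl//; apply: le_trans (fC h) _.
  apply: (@le_trans _ _ ((`|C| + 1) * h ^+ 2)).
    by rewrite ler_wpM2r ?sqr_ge0// (le_trans (ler_norm C))// lerDl.
  rewrite -(real_normK (num_real h)) mulrC expr2 -mulrA ler_pM2l//.
  rewrite -ler_pdivlMr//; near: h; apply: dnbhs0_le.
  by rewrite divr_gt0.
by split; [apply/cvg_ex; exists l|apply/cvg_lim].
Unshelve. all: by end_near. Qed.

(** Squaring smooths the corner of the positive part at 0 just enough for a C^1 cutoff. *)
Definition sqpos (s : R) := Num.max 0 s ^+ 2.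

Lemma is_derive_sqpos (s : R) : is_derive s 1 sqpos (2 * Num.max 0 s).
Proof.
(* In each of the four sign cases the remainder is at most h^2, whence the constant 1. *)
apply: (@is_derive_quadratic_remainder _ _ _ 1) => h; rewrite mul1r /sqpos.
have [s0|s0] := leP 0 s; have [hs0|hs0] := leP 0 (h + s); rewrite ler_norml; nra.
Qed.

Lemma sqpos_le1 (s : R) : s <= 1 -> 0 <= sqpos s <= 1.
Proof.
move=> s1; rewrite sqr_ge0 /sqpos expr_le1// ?le_max ?lexx//.
by rewrite ge_max ler01.
Qed.

End squared_positive_part.

Section pointwise_continuity.
Variables (R : realType) (T : topologicalType).
Implicit Types f g : T -> R.

Lemma continuous_add f g : continuous f -> continuous g ->
  continuous (fun x => f x + g x).
Proof. by move=> fc gc x; apply: cvgD; [exact: fc|exact: gc]. Qed.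

Lemma continuous_mul f g : continuous f -> continuous g ->
  continuous (fun x => f x * g x).
Proof. by move=> fc gc x; apply: cvgM; [exact: fc|exact: gc]. Qed.

Lemma continuous_opp f : continuous f -> continuous (fun x => - f x).
Proof. by move=> fc x; apply: cvgN; exact: fc. Qed.

Lemma continuous_apply f (h : R -> R) : continuous h -> continuous f ->
  continuous (fun x => h (f x)).
Proof.
by move=> hc fc x; apply: (@continuous_cvg _ _ _ _ _ f h); [exact: hc|exact: fc].
Qed.

Lemma continuous_bigsum (I : Type) (r : seq I) (F : I -> T -> R) :
  (forall i, continuous (F i)) -> continuous (fun x => \sum_(i <- r) F i x).
Proof.
move=> Fc; elim: r => [|i r IH].
  by under eq_fun do rewrite big_nil; exact: cst_continuous.
by under eq_fun do rewrite big_cons; exact: continuous_add.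
Qed.

End pointwise_continuity.

Section test_function.
Variables (R : realType) (d : nat) (A : 'rV[R]_d -> 'rV[R]_d).
Variables (theta dtheta : R -> R).
Hypothesis A2 : Ck_map 2 A.
Hypothesis theta_derive : forall u : R, is_derive u 1 theta (dtheta u).
Hypothesis dtheta_continuous : continuous dtheta.

Let Q x := \sum_(c < d) A x 0 c ^+ 2.
(** At this scale the cutoff [sqpos (1 - k n * Q x)] vanishes exactly when the Euclidean norm of
    A(x) is at least n + 1. *)
Let k n : R := n.+1%:R^-1 ^+ 2.

(* The quadratic cutoff makes [test_function n a] compactly supported and C^1,
   while keeping its derivatives bounded uniformly in [n]. *)
Definition test_function n (a : 'I_d) (x : 'rV[R]_d) : R :=
  theta (A x 0 a) * sqpos (1 - k n * Q x).

(** The argument [w] is the derivative of the map A along the direction, not the direction itself.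
    Along the conjugate flow it is a vector independent of [x]. *)
Definition test_derivative n (a : 'I_d) (x w : 'rV[R]_d) : R :=
  theta (A x 0 a) *
    (2 * Num.max 0 (1 - k n * Q x) * - (k n * \sum_(c < d) 2 * A x 0 c * w 0 c)) +
  dtheta (A x 0 a) * w 0 a * sqpos (1 - k n * Q x).

Lemma is_derive_test_function n a x v (w : 'rV[R]_d) :
  (forall c, is_derive x v (fun y => A y 0 c) (w 0 c)) ->
  is_derive x v (test_function n a) (test_derivative n a x w).
Proof.
move=> Aw.
have D1 := is_derive_comp_real (Aw a) (theta_derive (A x 0 a)).
have DQ : is_derive x v (fun y => 1 - k n * Q y)
    (- (k n * \sum_(c < d) 2 * A x 0 c * w 0 c)).
  have DQ' := is_derive_bigsum (fun c => is_deriveM (Aw c) (Aw c)) (index_enum 'I_d).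
  have -> : (fun y => 1 - k n * Q y) = cst (1 : R) -
     (cst (k n) * (fun y => \sum_(c < d) A y 0 c * A y 0 c)) by [].
  refine (is_derive_eq (is_deriveB (is_derive_cst (1 : R) x v)
    (is_deriveM (is_derive_cst (k n) x v) DQ')) _).
  rewrite sub0r scaler0 addr0; congr (- (_ * _)); apply: eq_bigr => c _.
  by rewrite -[_ *: _]/(A x 0 c * w 0 c) -mulrA mulr_natl.
have D2 := is_derive_comp_real DQ (is_derive_sqpos _).
refine (is_derive_eq (is_deriveM D1 D2) _).
by congr (_ + _); exact: mulrC.
Qed.

Lemma differentiable_test_function n a x : differentiable (test_function n a) x.
Proof.
have dA c : differentiable (fun y => A y 0 c) x by have [+ _] := A2 c; apply.
have dc (f df : R -> R) g : (forall u : R, is_derive u 1 f (df u)) ->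
    differentiable g x -> differentiable (fun y : 'rV[R]_d => f (g y)) x.
  move=> fdf dg; apply: (@differentiable_comp _ _ _ _ g f) => //.
  by apply/derivable1_diffP; have [] := fdf (g x).
apply: (@differentiableM _ _ (fun y => theta (A y 0 a))
  (fun y => sqpos (1 - k n * Q y))); first exact: (dc _ _ _ theta_derive).
apply: (dc _ _ _ (@is_derive_sqpos R)).
have -> : (fun y => 1 - k n * Q y) = cst (1 : R) -
    (k n *: \sum_(c < d) ((fun y => A y 0 c) * (fun y => A y 0 c))).
  by apply/funext => y; rewrite -[RHS]/(1 - k n * _) fct_sumE.
apply: differentiableB; first exact: differentiable_cst.
apply: differentiableZ; apply: differentiable_sum => c.
exact: differentiableM.
Qed.

Lemma continuous_coordinate c : continuous (fun y => A y 0 c).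
Proof. by move=> y; apply: differentiable_continuous; have [+ _] := A2 c; apply. Qed.

Let Q_continuous : continuous Q.
Proof.
apply: continuous_bigsum => c; under eq_fun do rewrite expr2.
by apply: continuous_mul; exact: continuous_coordinate.
Qed.

Let theta_continuous : continuous theta.
Proof.
move=> u; apply/differentiable_continuous/derivable1_diffP.
by have [] := theta_derive u.
Qed.

Let arg_continuous n : continuous (fun x => 1 - k n * Q x).
Proof.
apply: continuous_add; first exact: cst_continuous.
by apply/continuous_opp/continuous_mul; [exact: cst_continuous|].
Qed.

Let max_continuous : continuous (Num.max (0 : R)).
Proof.
move=> u; apply: (@continuous_max _ _ (cst 0) id); first exact: cst_continuous.
exact: cvg_id.
Qed.

Let sqpos_continuous : continuous (@sqpos R).
Proof.
move=> u; apply/differentiable_continuous/derivable1_diffP.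
by have [] := is_derive_sqpos u.
Qed.

Lemma continuous_test_derivative n a (w : 'rV[R]_d -> 'rV[R]_d) :
  (forall c, continuous (fun x => w x 0 c)) ->
  continuous (fun x => test_derivative n a x (w x)).
Proof.
move=> wc.
have cA := continuous_coordinate.
apply: continuous_add; apply: continuous_mul.
- exact: (continuous_apply theta_continuous (cA a)).
- apply: continuous_mul.
    apply: continuous_mul; first exact: cst_continuous.
    exact: (continuous_apply max_continuous (@arg_continuous n)).
  apply/continuous_opp/continuous_mul; first exact: cst_continuous.
  apply: continuous_bigsum => c; apply: continuous_mul => //.
  by apply: continuous_mul => //; exact: cst_continuous.
- apply: continuous_mul => //.
  exact: (continuous_apply dtheta_continuous (cA a)).
- exact: (continuous_apply sqpos_continuous (@arg_continuous n)).
Qed.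

Lemma test_function_Ck1 n a : Ck 1 (test_function n a).
Proof.
split => [x|b]; first exact: differentiable_test_function.
have -> : partial b (test_function n a) = (fun x =>
    test_derivative n a x (\row_c partial b (fun y => A y 0 c) x)).
  apply/funext => x; apply: derive_val; apply: is_derive_test_function => c.
  rewrite mxE; exact: Ck_partial_derive (A2 c).
apply: continuous_test_derivative => c; under eq_fun do rewrite mxE.
by move=> x; apply: differentiable_continuous; have [_ /(_ b)[+ _]] := A2 c; apply.
Qed.

Let k_gt0 n : 0 < k n. Proof. by rewrite exprn_gt0// invr_gt0. Qed.

Let Q_ge0 x : 0 <= Q x. Proof. by apply: sumr_ge0 => c _; exact: sqr_ge0. Qed.

Let sqr_le_Q x c : A x 0 c ^+ 2 <= Q x.
Proof.
by rewrite /Q (bigD1 c)//= lerDl sumr_ge0// => i _; exact: sqr_ge0.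
Qed.

Let coordinate_bound n x c : 0 <= 1 - k n * Q x -> `|A x 0 c| <= n.+1%:R.
Proof.
rewrite subr_ge0 => kQ; rewrite -ler_sqr ?nnegrE// real_normK ?num_real//.
apply: le_trans (sqr_le_Q x c) _.
have n0 : 0 < n.+1%:R ^+ 2 :> R by rewrite exprn_gt0.
by move: kQ; rewrite /k exprVn mulrC ler_pdivrMr// mul1r.
Qed.

(** Where the cutoff is nonzero, A(x) lies in a cube of half-side n + 1. The image of that cube
    under the continuous inverse of A is compact and contains the support. *)
Lemma test_function_Cc1 n a : (exists2 G, cancel A G & Ck_map 1 G) ->
  Cc1 (test_function n a).
Proof.
move=> [G AG G1]; split; first exact: test_function_Ck1.
pose box : set 'rV[R]_d :=
  [set v | forall c, `[- n.+1%:R, n.+1%:R]%classic (v ord0 c)].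
exists (G @` box).
  apply: continuous_compact.
    apply: continuous_subspaceT => x; apply: differentiable_continuous.
    exact: Ck_map_differentiable G1.
  apply: (@rV_compact R d (fun=> `[- n.+1%:R, n.+1%:R]%classic)) => c.
  exact: segment_compact.
move=> x nx; rewrite /test_function.
have [s0|/ltW s0] := leP (1 - k n * Q x) 0.
  by rewrite /sqpos max_l// expr0n mulr0.
exfalso; apply: nx; exists (A x); last exact: AG.
by move=> c; rewrite /= in_itv/= -ler_norml; exact: coordinate_bound s0.
Qed.

Lemma test_function_le n a x : `|test_function n a x| <= `|theta (A x 0 a)|.
Proof.
have /andP[s0 s1] : 0 <= sqpos (1 - k n * Q x) <= 1.
  by apply: sqpos_le1; rewrite gerBl mulr_ge0// ltW.
by rewrite normrM (ger0_norm s0) ler_piMr.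
Qed.

(** The bound is uniform in [n]. Off the support all terms vanish. On it, with r = n + 1 and S the
    sum on the right, |theta| <= 1 + r <= 2r, the derivative of [sqpos] is at most 2, and the
    derivative of its argument is at most r^-2 (2 r S): together 8 S. The term with [dtheta] adds
    S. *)
Lemma test_derivative_le n a x (w : 'rV[R]_d) :
  `|theta (A x 0 a)| <= 1 + `|A x 0 a| -> `|dtheta (A x 0 a)| <= 1 ->
  `|test_derivative n a x w| <= 9 * \sum_(c < d) `|w 0 c|.
Proof.
move=> th dth; set S := \sum_(c < d) `|w 0 c|.
have S0 : 0 <= S by exact: sumr_ge0.
have [s0|s0] := leP (1 - k n * Q x) 0.
  rewrite /test_derivative /sqpos max_l// expr0n !(mulr0, mul0r) addr0 normr0.
  by rewrite mulr_ge0.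
have cb c := coordinate_bound c (ltW s0).
have /andP[q0 q1] : 0 <= sqpos (1 - k n * Q x) <= 1.
  by apply: sqpos_le1; rewrite gerBl mulr_ge0// ltW.
have s1 : 1 - k n * Q x <= 1 by rewrite gerBl mulr_ge0// ltW.
pose r : R := n.+1%:R; have r1 : 1 <= r by rewrite ler1n.
have r0 : 0 < r by rewrite ltr0n.
have sumb : `|\sum_(c < d) 2 * A x 0 c * w 0 c| <= 2 * r * S.
  apply: le_trans (ler_norm_sum _ _ _) _; rewrite mulr_sumr.
  apply: ler_sum => c _; rewrite !normrM ger0_norm// -!mulrA ler_pM2l//.
  by rewrite ler_wpM2r//; exact: cb.
apply: le_trans (ler_normD _ _) _.
rewrite (_ : 9 * S = 8 * S + S); last by ring.
apply: lerD; last first.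
  rewrite normrM (ger0_norm q0) normrM; apply: le_trans (_ : 1 * S * 1 <= _); last first.
    by rewrite mul1r mulr1.
  apply: ler_pM => //.
  apply: ler_pM => //.
  by rewrite /S (bigD1 a)//= lerDl sumr_ge0.
rewrite max_r ?(ltW s0)// normrM.
have -> : 8 * S = (2 * r) * (2 * (r^-1 ^+ 2 * (2 * r * S))).
  rewrite exprVn; field; exact: lt0r_neq0.
apply: ler_pM => //.
  by apply: le_trans th _; have := cb a; rewrite -/r => ?; lra.
rewrite normrM; apply: ler_pM => //.
  rewrite ger0_norm; last by rewrite mulr_ge0// ltW.
  lra.
rewrite normrN normrM ger0_norm; last exact: ltW.
by rewrite ler_pM2l.
Qed.

Let k_cvg0 : k @ \oo --> 0.
Proof.
have -> : k = (fun n => harmonic n * harmonic n).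
  by apply/funext => n; rewrite /k expr2.
by rewrite -[X in _ --> X](mulr0 (0 : R)); apply: cvgM; exact: cvg_harmonic.
Qed.

Let arg_cvg1 x : (fun n => 1 - k n * Q x) @ \oo --> (1 : R).
Proof.
rewrite -[X in _ --> X]subr0; apply: cvgB; first exact: cvg_cst.
by rewrite -[X in _ --> X](mul0r (Q x)); apply: cvgM; [exact: k_cvg0|exact: cvg_cst].
Qed.

Let sqpos_cvg1 x : (fun n => sqpos (1 - k n * Q x)) @ \oo --> (1 : R).
Proof.
have sqpos1 : sqpos 1 = (1 : R) by rewrite /sqpos max_r// expr1n.
rewrite -[X in _ --> X]sqpos1.
apply: (@continuous_cvg _ _ _ _ _ (fun n => 1 - k n * Q x) (@sqpos R)).
  exact: sqpos_continuous.
exact: arg_cvg1.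
Qed.

Lemma test_function_cvg a x : test_function ^~ a ^~ x @ \oo --> theta (A x 0 a).
Proof.
rewrite -[X in _ --> X]mulr1; apply: cvgM; first exact: cvg_cst.
exact: sqpos_cvg1.
Qed.

Lemma test_derivative_cvg a x w :
  (fun n => test_derivative n a x w) @ \oo --> dtheta (A x 0 a) * w 0 a.
Proof.
rewrite -[X in _ --> X]add0r; apply: cvgD; last first.
  rewrite -[X in _ --> X]mulr1; apply: cvgM; first exact: cvg_cst.
  exact: sqpos_cvg1.
rewrite -[X in _ --> X](mulr0 (theta (A x 0 a))); apply: cvgM; first exact: cvg_cst.
rewrite -[X in _ --> X](mulr0 (2 * Num.max 0 (1 : R))); apply: cvgM.
  apply: cvgM; first exact: cvg_cst.
  apply: (@continuous_cvg _ _ _ _ _ (fun n => 1 - k n * Q x) (Num.max (0 : R))).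
    exact: max_continuous.
  exact: arg_cvg1.
rewrite -[X in _ --> X]oppr0; apply: cvgN.
rewrite -[X in _ --> X](mul0r (\sum_(c < d) 2 * A x 0 c * w 0 c)).
by apply: cvgM; [exact: k_cvg0|exact: cvg_cst].
Qed.

End test_function.

(** * The conjugate mean-field flow *)

Section real_integrals.
Context dd (T : measurableType dd) (R : realType).

Lemma dominated_Rintegral (mu : {measure set T -> \bar R}) (D : set T)
    (f_ : nat -> T -> R) (f g : T -> R) : measurable D ->
  (forall n, measurable_fun D (f_ n)) ->
  (forall x, D x -> f_ ^~ x @ \oo --> f x) ->
  mu.-integrable D (EFin \o g) ->
  (forall n x, D x -> `|f_ n x| <= g x) ->
  mu.-integrable D (EFin \o f) /\
  (fun n => \int[mu]_(x in D) f_ n x) @ \oo --> \int[mu]_(x in D) f x.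
Proof.
move=> mD mf_ f_f ig f_g.
have mf : measurable_fun D f by exact: measurable_fun_cvg mf_ f_f.
have [||||intf _ cvgf] := @dominated_convergence _ _ _ mu D mD
  (fun n => EFin \o f_ n) (EFin \o f) (EFin \o g) _ _ _ ig _.
- by move=> n; exact/measurable_EFinP.
- exact/measurable_EFinP.
- by apply: aeW => x Dx; apply: cvg_EFin; [by apply: nearW|exact: f_f].
- by apply: aeW => x n Dx; rewrite /= lee_fin; exact: f_g.
split => //.
have finf : (\int[mu]_(x in D) (f x)%:E)%E \is a fin_num.
  exact: integrable_fin_num intf.
by apply: fine_cvg; rewrite /Rintegral fineK.
Qed.

Lemma normr_Rintegral_le_cst (P : probability T R) (f : T -> R) (C : R) :
  measurable_fun setT f -> (forall x, `|f x| <= C) ->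
  P.-integrable setT (EFin \o f) /\ `|\int[P]_x f x| <= C.
Proof.
move=> mf fC.
have iC : P.-integrable setT (EFin \o cst C).
  by apply: finite_measure_integrable_cst.
have intf : P.-integrable setT (EFin \o f).
  apply: le_integrable iC => //; first exact/measurable_EFinP.
  by move=> x _; rewrite /= lee_fin (le_trans (fC x))// ler_norm.
split => //; apply: le_trans (le_normr_Rintegral _ intf) _ => //.
apply: (@le_trans _ _ (\int[P]_x (cst C x))).
  by apply: le_Rintegral => //; exact: integrable_norm.
rewrite Rintegral_cst//.
have -> : fine (P setT) = 1 by rewrite probability_setT.
by rewrite mulr1.
Qed.

End real_integrals.

Section vector_integral.
Context {R : realType} {d : nat}.
Local Notation E := (borelRV R d).

Lemma vint_mulmx (rho : {measure set E -> \bar R}) (f : E -> 'rV[R]_d)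
    (B : 'M[R]_d) :
  (forall a, rho.-integrable setT (fun y => (f y 0 a)%:E)) ->
  vint rho (fun y => f y *m B) = vint rho f *m B.
Proof.
move=> intf; apply/rowP => a; rewrite !mxE.
under eq_integral do rewrite mxE -sumEFin.
rewrite integral_sum//; last first.
  by move=> c; under eq_fun do rewrite EFinM; exact: integrableZr.
rewrite (eq_bigr (fun c => (vint rho f 0 c * B c a)%:E)); first by rewrite sumEFin.
move=> c _; under eq_integral do rewrite EFinM.
rewrite integralZr// EFinM mxE fineK//.
exact: integrable_fin_num.
Qed.

Lemma integrable_mulmx (rho : {measure set E -> \bar R}) (f : E -> 'rV[R]_d)
    (B : 'M[R]_d) a :
  (forall c, rho.-integrable setT (fun y => (f y 0 c)%:E)) ->
  rho.-integrable setT (fun y => ((f y *m B) 0 a)%:E).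
Proof.
move=> intf; under eq_fun do rewrite mxE -sumEFin.
apply: integrable_sum => // c _.
by under eq_fun do rewrite EFinM; exact: integrableZr.
Qed.

Lemma normr_le_enorm (v : 'rV[R]_d) b : `|v 0 b| <= enorm v.
Proof.
rewrite -sqrtr_sqr ler_sqrt; last by apply: sumr_ge0 => i _; exact: sqr_ge0.
by rewrite (bigD1 b)//= lerDl sumr_ge0// => i _; exact: sqr_ge0.
Qed.

Lemma sum_normr_mulmx_le (v : 'rV[R]_d) (B : 'M[R]_d) :
  \sum_c `|(v *m B) 0 c| <= (\sum_c \sum_b `|B b c|) * enorm v.
Proof.
rewrite mulr_suml; apply: ler_sum => c _; rewrite mxE mulr_suml.
apply: le_trans (ler_norm_sum _ _ _) _; apply: ler_sum => b _.
by rewrite normrM mulrC ler_wpM2l// normr_le_enorm.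
Qed.

End vector_integral.

Section conjugate_flow.
Context {R : realType} {d : nat}.
Local Notation E := (borelRV R d).
Variable A : 'rV[R]_d -> 'rV[R]_d.
Hypothesis A3 : Ck_map 3 A.
Hypothesis detA : forall x, 0 < \det (Dmx A x).

Lemma Dmx_mulVT x (v : 'rV[R]_d) :
  v *m (invmx (Dmx A x))^T *m (Dmx A x)^T = v.
Proof.
by rewrite -mulmxA -trmx_mul mulmxV ?trmx1 ?mulmx1// Dmx_unit.
Qed.

(** The drift is linear in A(y) through a matrix depending on [x] alone, so integrability of A lets
    that matrix leave the integral. *)
Lemma velocity_conjugate (rho : {measure set E -> \bar R}) (x : 'rV[R]_d) :
  (forall a, rho.-integrable setT (fun y : E => (A y 0 a)%:E)) ->
  velocity (VA A) (KA1 A) rho x =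
  - (vint rho A *m (invmx (Dmx A x))^T).
Proof.
move=> intA; rewrite /velocity -mulmxN -vint_mulmx//; congr vint.
by apply/funext => y; rewrite drift_conjugate// mulmxN.
Qed.

Lemma is_derive_coordinate x v c :
  is_derive x v (fun y => A y 0 c) ((v *m (Dmx A x)^T) 0 c).
Proof.
have dA : differentiable A x := Ck_map_differentiable x A3.
have dvA : derivable A x v by exact: diff_derivable.
split; first exact: (derivable_mxP _ _ _).1 dvA 0 c.
rewrite /Dmx trmxK -deriveEjacobian// derive_mx// mxE//.
Qed.

Lemma sum_partialE (f : 'rV[R]_d -> R) x (v : 'rV[R]_d) : differentiable f x ->
  \sum_a partial a f x * v 0 a = 'D_v f x.
Proof.
move=> df; rewrite deriveE// {2}(row_sum_delta v) linear_sum/=.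
by apply: eq_bigr => a _; rewrite linearZ/= /partial deriveE// mulrC.
Qed.

Lemma A_coordinate_measurable a : measurable_fun setT (fun y : E => A y 0 a).
Proof.
apply: continuous_measurable_borel => y; apply: differentiable_continuous.
by have [+ _] := A3 a; apply.
Qed.

End conjugate_flow.

Section mean_field.
Context {R : realType} {d : nat}.
Local Notation E := (borelRV R d).
Local Notation leb := lebesgue_measure.
Variables (A : 'rV[R]_d -> 'rV[R]_d).
Variables (mu0 : probability E R) (mu : R -> probability E R).
Hypothesis A3 : Ck_map 3 A.
Hypothesis Ainv : exists2 G, cancel A G & Ck_map 1 G.
Hypothesis detA : forall x, 0 < \det (Dmx A x).
Hypothesis mf : mean_field_solution (VA A) (KA1 A) mu0 mu.

Let m t : 'rV[R]_d := vint (mu t) A.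

(** Integrability of the drift at the point 0 is part of being a solution, and multiplying that
    drift by - DA(0)^T gives back A(y). *)
Lemma mean_field_integrable t a : 0 <= t ->
  (mu t).-integrable setT (fun y : E => (A y 0 a)%:E).
Proof.
move=> t0.
have -> : (fun y : E => (A y 0 a)%:E) =
    (fun y : E => ((drift (VA A) (KA1 A) 0 y *m - (Dmx A 0)^T) 0 a)%:E).
  by apply/funext => y; rewrite drift_conjugate// mulNmx mulmxN opprK Dmx_mulVT.
by apply: integrable_mulmx => c; exact: mf_integrable mf _ t0 _ _.
Qed.

Let velocityE t x : 0 <= t ->
  velocity (VA A) (KA1 A) (mu t) x = - (m t *m (invmx (Dmx A x))^T).
Proof.
by move=> t0; apply: velocity_conjugate => // a; exact: mean_field_integrable.
Qed.

(* [m t] is recovered from the velocity at the single point 0. *)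
Let mean_bound T : exists2 g : R -> R, leb.-integrable `[0, T] (EFin \o g) &
  forall t, t \in `[0, T] -> \sum_c `|(- m t) 0 c| <= g t.
Proof.
have [g ig gb] := mf_locally_bounded mf T (@compact_set1 _ (0 : 'rV[R]_d)).
pose K := \sum_c \sum_b `|(Dmx A 0)^T b c|.
exists (fun t => K * g t).
  have -> : EFin \o (fun t => K * g t) = (fun t => K%:E * (EFin \o g) t)%E by [].
  exact: integrableZl.
move=> t tT; have t0 : 0 <= t by move: tT; rewrite in_itv/= => /andP[].
rewrite -(Dmx_mulVT detA 0 (- m t)) mulNmx -velocityE//.
apply: le_trans (sum_normr_mulmx_le _ _) _.
rewrite ler_wpM2l//; last exact: gb.
by apply: sumr_ge0 => c _; exact: sumr_ge0.
Qed.

Section transport.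
Variables (theta dtheta : R -> R) (a : 'I_d).
Hypothesis theta_derive : forall u : R, is_derive u 1 theta (dtheta u).
Hypothesis dtheta_continuous : continuous dtheta.
Hypothesis theta_le : forall u, `|theta u| <= 1 + `|u|.
Hypothesis dtheta_le : forall u, `|dtheta u| <= 1.

Let A2 : Ck_map 2 A.
Proof.
move=> c; have [dA CA] := A3 c; split => // b; have [dA' CA'] := CA b.
split => // b'; have [dA'' _] := CA' b' => y.
exact/differentiable_continuous/dA''.
Qed.

Let phi n := test_function A theta n a.

Let phi_continuous n : continuous (phi n).
Proof.
move=> x; apply: differentiable_continuous.
exact: (differentiable_test_function A2 theta_derive).
Qed.

Let cA c : continuous (fun y => A y 0 c).
Proof. exact: (@continuous_coordinate _ _ _ A2 c). Qed.

Let theta_continuous : continuous theta.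
Proof.
move=> u; apply/differentiable_continuous/derivable1_diffP.
by have [] := theta_derive u.
Qed.

Let mA c : measurable_fun setT (fun y : E => A y 0 c).
Proof. exact: (continuous_measurable_borel (@cA c)). Qed.

Let integrable_theta_bound t : 0 <= t ->
  (mu t).-integrable setT (EFin \o (fun y : E => 1 + `|A y 0 a|)).
Proof.
move=> t0; have -> : EFin \o (fun y : E => 1 + `|A y 0 a|) =
    (fun y : E => (cst 1%E y + `|(A y 0 a)%:E|)%E) by [].
apply: integrableD => //; first exact: finite_measure_integrable_cst.
exact/integrable_abse/mean_field_integrable.
Qed.

Lemma integrable_theta t : 0 <= t ->
  (mu t).-integrable setT (EFin \o (fun y : E => theta (A y 0 a))).
Proof.
move=> t0; apply: le_integrable (integrable_theta_bound t0) => //.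
  apply/measurable_EFinP; apply: continuous_measurable_borel.
  exact: (continuous_apply theta_continuous (@cA a)).
move=> y _; rewrite /= lee_fin (le_trans (theta_le _))//.
exact: ler_norm.
Qed.

Let phi_cvg t : 0 <= t -> (fun n => \int[mu t]_x phi n x) @ \oo -->
  \int[mu t]_x theta (A x 0 a).
Proof.
move=> t0; have [||||//] := @dominated_Rintegral _ E R (mu t) setT phi
  (fun x => theta (A x 0 a)) (fun x => 1 + `|A x 0 a|) measurableT.
- by move=> n; exact: continuous_measurable_borel (@phi_continuous n).
- by move=> x _; exact: test_function_cvg.
- exact: integrable_theta_bound.
- by move=> n x _; exact: le_trans (test_function_le _ _ _ _ _) (theta_le _).
Qed.

(** The factor DA(x) from the chain rule cancels DA(x)^-1 in the velocity, so A changes along the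
    flow at the rate [- m s], whatever the point [x]. *)
Let fluxE s n : 0 <= s -> flux (VA A) (KA1 A) (mu s) (phi n) =
  \int[mu s]_x test_derivative A theta dtheta n a x (- m s).
Proof.
move=> s0; rewrite /flux /Rintegral; congr fine; apply: eq_integral => x _.
congr _%:E; rewrite velocityE// sum_partialE; last first.
  exact: (differentiable_test_function A2 theta_derive).
apply: derive_val; apply: is_derive_test_function => // c.
have -> : (- m s) 0 c = (- (m s *m (invmx (Dmx A x))^T) *m (Dmx A x)^T) 0 c.
  by rewrite mulNmx Dmx_mulVT.
exact: is_derive_coordinate.
Qed.

Let D s : R := \int[mu s]_x (dtheta (A x 0 a) * (- m s) 0 a).

Let measurable_test_derivative s n :
  measurable_fun setT (fun x : E => test_derivative A theta dtheta n a x (- m s)).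
Proof.
apply: continuous_measurable_borel.
exact: (@continuous_test_derivative R d A theta dtheta A2 theta_derive
  dtheta_continuous n a (fun=> - m s) (fun c => @cst_continuous _ _ _)).
Qed.

Let flux_cvg s : 0 <= s ->
  (fun n => flux (VA A) (KA1 A) (mu s) (phi n)) @ \oo --> D s.
Proof.
move=> s0; under eq_fun do rewrite fluxE//.
have [||||//] := @dominated_Rintegral _ E R (mu s) setT
  (fun n x => test_derivative A theta dtheta n a x (- m s))
  (fun x => dtheta (A x 0 a) * (- m s) 0 a)
  (fun=> 9 * \sum_c `|(- m s) 0 c|) measurableT.
- by move=> n; exact: (@measurable_test_derivative s n).
- by move=> x _; exact: test_derivative_cvg.
- exact: finite_measure_integrable_cst.
- by move=> n x _; exact: test_derivative_le.
Qed.

Let flux_le s n : 0 <= s ->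
  `|flux (VA A) (KA1 A) (mu s) (phi n)| <= 9 * \sum_c `|(- m s) 0 c|.
Proof.
move=> s0; rewrite fluxE//; have [|_ //] := @normr_Rintegral_le_cst _ E R (mu s)
  (fun x => test_derivative A theta dtheta n a x (- m s))
  (9 * \sum_c `|(- m s) 0 c|) (@measurable_test_derivative s n) _.
by move=> x; exact: test_derivative_le.
Qed.

(** The weak equation for [phi n] passes to the limit by dominated convergence. In space, the
    dominating functions are 1 + |A_a| for [phi n] and a constant, nine times the l^1 norm of [m s],
    for the fluxes; in time it is [9 * g], with [g] the integrable bound on the means. *)
Lemma mean_field_transport t : 0 <= t ->
  leb.-integrable `[0, t] (EFin \o D) /\
  \int[mu t]_x theta (A x 0 a) =
  \int[mu 0]_x theta (A x 0 a) + \int[leb]_(s in `[0, t]) D s.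
Proof.
move=> t0; have [g ig gb] := mean_bound t.
have s0 s : `[0, t]%classic s -> 0 <= s by rewrite /= in_itv/= => /andP[].
have weak n := mf_weak mf (test_function_Cc1 A2 theta_derive dtheta_continuous
  n a Ainv) t0.
have [||||iD cD] := @dominated_Rintegral _ _ R leb `[0, t]%classic
  (fun n s => flux (VA A) (KA1 A) (mu s) (phi n)) D (fun s => 9 * g s)
  (@measurable_itv R _).
- move=> n; have [/measurable_int/measurable_EFinP] := weak n; exact.
- by move=> s /s0; exact: flux_cvg.
- have -> : EFin \o (fun s => 9 * g s) = (fun s => 9%:E * (EFin \o g) s)%E.
    by [].
  exact: integrableZl.
- move=> n s st; apply: le_trans (flux_le _ (s0 _ st)) _.
  by rewrite ler_pM2l//; apply: gb; exact: st.
split => //; rewrite addrC; apply/eqP; rewrite -subr_eq; apply/eqP.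
rewrite -(cvg_lim (@Rhausdorff R) cD); apply/esym/cvg_lim; first exact: Rhausdorff.
rewrite (_ : (fun n => _) = (fun n => \int[mu t]_x phi n x - \int[mu 0]_x phi n x)).
  exact: cvgB (@phi_cvg t t0) (@phi_cvg 0 (lexx 0)).
apply/funext => n; have [_ <-] := weak n.
(* The weak equation starts from [mu0], which is known to agree with [mu 0] on measurable sets;
   integrals depend on nothing else. *)
congr (_ - _); rewrite /Rintegral; congr fine; apply/esym.
by apply: eq_set_function_integral => B mB; exact: mf_init mf _ mB.
Qed.

End transport.
End mean_field.

(** * Decay of the mean and first-moment bounds for the mean-field flow *)

Section regularized_norm.
Variable R : realType.

(* A C^1 substitute for the absolute value: transporting it bounds the first
   moments of A locally uniformly in time, as Fubini requires for time averages. *)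
Definition soft_abs (u : R) := Num.sqrt (1 + u ^+ 2).
(** Kept in the shape produced by the chain rule: the derivative of the square root times that of 1
    + u^2. *)
Definition soft_sign (u : R) := (2 * Num.sqrt (1 + u ^+ 2))^-1 * (2 * u).

Let soft_gt0 (u : R) : 0 < 1 + u ^+ 2.
Proof. by rewrite ltr_pwDl// sqr_ge0. Qed.

Lemma is_derive_soft_abs (u : R) : is_derive u 1 soft_abs (soft_sign u).
Proof.
have Dsq : is_derive u (1 : R) (fun v : R => 1 + v ^+ 2) (2 * u).
  refine (is_derive_eq (is_deriveD (is_derive_cst (1 : R) u 1)
    (is_deriveX 2 (is_derive_id u (1 : R)))) _).
  by rewrite add0r expr1 [_ *: _]mulr1.
exact: is_derive_comp_real Dsq (is_derive1_sqrt (soft_gt0 u)).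
Qed.

Lemma soft_sign_continuous : continuous soft_sign.
Proof.
have cs : continuous soft_abs.
  move=> u; apply/differentiable_continuous/derivable1_diffP.
  by have [] := is_derive_soft_abs u.
apply: continuous_mul.
  move=> u; apply: cvgV; first by rewrite mulf_neq0// gt_eqF// sqrtr_gt0.
  by apply: cvgM; [exact: cvg_cst|exact: cs].
by apply: continuous_mul; [exact: cst_continuous|move=> u; exact: cvg_id].
Qed.

Lemma normr_le_soft_abs (u : R) : `|u| <= soft_abs u.
Proof. by rewrite -sqrtr_sqr ler_sqrt; [rewrite lerDr|exact: ltW]. Qed.

Lemma soft_abs_le (u : R) : `|soft_abs u| <= 1 + `|u|.
Proof.
rewrite ger0_norm ?sqrtr_ge0// -(ger0_norm (_ : 0 <= 1 + `|u|)) ?addr_ge0//.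
rewrite -sqrtr_sqr ler_sqrt ?sqr_ge0// sqrrD expr1n real_normK ?num_real//.
by rewrite mul1r lerD2r lerDl mulrn_wge0.
Qed.

Lemma normr_soft_sign_le1 (u : R) : `|soft_sign u| <= 1.
Proof.
have -> : soft_sign u = (Num.sqrt (1 + u ^+ 2))^-1 * u.
  by rewrite /soft_sign; field; rewrite gt_eqF// sqrtr_gt0.
rewrite normrM normfV.
rewrite (@ger0_norm _ (Num.sqrt _)) ?sqrtr_ge0// ler_pdivrMl ?sqrtr_gt0//.
by rewrite mulr1 normr_le_soft_abs.
Qed.

End regularized_norm.

Section mean_field_decay.
Context {R : realType} {d : nat}.
Local Notation E := (borelRV R d).
Local Notation leb := lebesgue_measure.
Variables (A : 'rV[R]_d -> 'rV[R]_d).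
Variables (mu0 : probability E R) (mu : R -> probability E R).
Hypothesis A3 : Ck_map 3 A.
Hypothesis Ainv : exists2 G, cancel A G & Ck_map 1 G.
Hypothesis detA : forall x, 0 < \det (Dmx A x).
Hypothesis mf : mean_field_solution (VA A) (KA1 A) mu0 mu.

(** Transporting theta = id turns the weak equation into the Volterra equation u(t) = u(0) -
    (integral of u over [0, t]) for each coordinate of the mean. *)
Lemma mean_field_decay t : 0 <= t ->
  vint (mu t) A = expR (- t) *: vint (mu 0) A.
Proof.
move=> t0; apply/rowP => a.
pose u t := (vint (mu t) A) 0 a.
have DE s : \int[mu s]_x (1 * (- vint (mu s) A) 0 a) = - u s.
  have := @Rintegral_cst _ E R (mu s) setT measurableT (- u s).
  have -> : fine (mu s setT) = 1 by rewrite probability_setT.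
  by rewrite mulr1 => <-; apply: eq_Rintegral => x _; rewrite mul1r mxE.
have tr s : 0 <= s ->
    leb.-integrable `[0, s] (EFin \o (fun r => - u r)) /\
    u s = u 0 + \int[leb]_(r in `[0, s]) (- u r).
  have <- : (fun r => \int[mu r]_x (1 * (- vint (mu r) A) 0 a)) = (fun r => - u r).
    exact: funext DE.
  have uE r : u r = \int[mu r]_x A x 0 a by rewrite /u mxE.
  rewrite !uE.
  apply: (@mean_field_transport R d A mu0 mu A3 Ainv detA mf id (cst (1 : R)) a).
  - exact: cst_continuous.
  - by move=> r; rewrite lerDr.
  - by move=> r; rewrite normr1.
have iu s : 0 <= s -> leb.-integrable `[0, s] (EFin \o u).
  move=> /tr[+ _].
  move=> /integrableN; apply: eq_integrable => // r _.
  by rewrite /= opprK.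
rewrite [RHS]mxE; apply: (@volterra_exponential_decay _ u) => // s s0.
have [_ ->] := tr _ s0; congr (_ + _).
transitivity (\int[leb]_(r in `[0, s]) (-1 * u r)).
  by apply: eq_Rintegral => r _; rewrite mulN1r.
by rewrite RintegralZl ?mulN1r//; exact: iu.
Qed.

(** |A_a| is dominated by [soft_abs] of A_a, whose mean at time t is its initial value plus the
    integral of [D] over [0, t]. Replacing [D] by |D| and t by T makes the bound independent of
    t. *)
Lemma mean_field_first_moment_bound a T : exists C : R,
  forall t, 0 <= t <= T -> (\int[mu t]_x `|A x 0 a|%R%:E <= C%:E)%E.
Proof.
have [T0|T0] := leP 0 T; last first.
  by exists 0 => t /andP[t0 tT]; have := le_trans t0 tT; rewrite leNgt T0.
have tr s (s0 : 0 <= s) := mean_field_transport A3 Ainv detA mf a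
  (@is_derive_soft_abs R) (@soft_sign_continuous R)
  (@soft_abs_le R) (@normr_soft_sign_le1 R) s0.
pose D s := \int[mu s]_x (soft_sign (A x 0 a) * (- vint (mu s) A) 0 a).
exists (\int[mu 0]_x soft_abs (A x 0 a) + \int[leb]_(s in `[0, T]) `|D s|).
move=> t /andP[t0 tT].
have is_ := integrable_theta A3 detA mf a (@is_derive_soft_abs R) (@soft_abs_le R) t0.
have mA := A_coordinate_measurable A3 a.
apply: (@le_trans _ _ (\int[mu t]_x (soft_abs (A x 0 a))%:E)%E).
  apply: ge0_le_integral => //.
  - by apply/measurable_EFinP/measurableT_comp.
  - exact: measurable_int is_.
  - by move=> x _; rewrite lee_fin normr_le_soft_abs.
have -> : (\int[mu t]_x (soft_abs (A x 0 a))%:E =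
    (\int[mu t]_x soft_abs (A x 0 a))%:E)%E.
  by rewrite /Rintegral fineK//; exact: integrable_fin_num is_.
rewrite lee_fin.
have [iDt ->] := tr _ t0; have [iDT _] := tr _ T0.
rewrite lerD2l; apply: le_trans (ler_norm _) _.
apply: le_trans (le_normr_Rintegral _ iDt) _ => //.
have iDt' : leb.-integrable `[0, t] (EFin \o (fun s => `|D s|)) by exact: integrable_norm.
have iDT' : leb.-integrable `[0, T] (EFin \o (fun s => `|D s|)) by exact: integrable_norm.
rewrite -lee_fin /Rintegral !fineK; try exact: integrable_fin_num.
apply: ge0_subset_integral => //; first exact: measurable_int iDT'.
by move=> s /=; rewrite !in_itv/= => /andP[-> st]; exact: le_trans tT.
Qed.

End mean_field_decay.

(** * Time averages of curves with exponentially decaying mean *)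

Section time_average_decay.
Context {R : realType} {d : nat}.
Local Notation E := (borelRV R d).
Local Notation leb := lebesgue_measure.
Variables (A : 'rV[R]_d -> 'rV[R]_d) (nu : R -> giry E R) (v : 'rV[R]_d).
Hypothesis mA : forall a, measurable_fun setT (fun y : E => A y 0 a).
Hypothesis nu_narrow : forall f : 'rV[R]_d -> R, continuous f ->
  (exists C : R, forall x, `|f x| <= C) ->
  {within `[0, +oo[, continuous (fun t => \int[nu t]_x f x)}.
Hypothesis nu_bound : forall a T, exists C : R,
  forall t, 0 <= t <= T -> (\int[nu t]_x `|A x 0 a|%R%:E <= C%:E)%E.
Hypothesis nu_decay : forall t, 0 <= t -> vint (nu t) A = expR (- t) *: v.

Lemma integrable_expRN (T : R) : leb.-integrable `[0, T] (EFin \o (fun t : R => expR (- t))).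
Proof.
apply: continuous_compact_integrable; first exact: segment_compact.
apply: continuous_subspaceT => x.
apply: (@continuous_cvg _ _ _ _ _ (fun t : R => - t) expR).
  exact: continuous_expR.
by apply: cvgN; exact: cvg_id.
Qed.

(** Stated for an abstract curve so as to serve the particles and the mean-field flow alike. The
    scalar depends on [T] only, so the two averaged means differ by that multiple of their initial
    difference. *)
Lemma vint_time_average_decay (T : R) : 0 < T ->
  vint (time_average T nu) A =
  (T^-1 * \int[leb]_(t in `[0, T]) expR (- t)) *: v.
Proof.
move=> T0; apply/rowP => a; rewrite !mxE.
have [C bC] := nu_bound a T.
rewrite (integral_time_average nu_narrow T0 (mA a) bC) -mulrA; congr (_ * _).
rewrite -RintegralZr//; last exact: integrable_expRN.
apply: eq_Rintegral => t; rewrite inE/= in_itv/= => /andP[t0 _].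
by have /rowP/(_ a) := nu_decay t0; rewrite !mxE.
Qed.

End time_average_decay.

(** * The particle system *)

(** Full differentiability of [f] enters here: directional derivatives alone do not compose with a
    curve that is not a line. *)
Lemma is_derive_along_curve (R : realType) (V : normedModType R) (f : V -> R)
    (x : R -> V) (t l : R) (w : V) : differentiable f (x t) ->
  is_derive t 1 x w -> is_derive (x t) w f l ->
  is_derive t 1 (fun s => f (x s)) l.
Proof.
move=> df [dx xw] [_ <-].
have dx' : differentiable x t by exact/derivable1_diffP.
have dfx : differentiable (f \o x) t by exact: differentiable_comp.
split; first exact/derivable1_diffP.
rewrite (deriveE _ dfx) diff_comp//= -(deriveE _ dx') xw.
by rewrite deriveE.
Qed.

Lemma within_continuous_comp (T U V : topologicalType) (D : set T)
    (f : T -> U) (g : U -> V) :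
  {within D, continuous f} -> continuous g ->
  {within D, continuous (fun x => g (f x))}.
Proof.
move=> fc gc x.
by apply: (@continuous_comp (subspace D) U V f g); [exact: fc|exact: gc].
Qed.

Section particles.
Context {R : realType} {d : nat}.
Local Notation E := (borelRV R d).
Variables (A : 'rV[R]_d -> 'rV[R]_d) (N : nat).
Variables (x0 : 'I_N -> 'rV[R]_d) (x : 'I_N -> R -> 'rV[R]_d).
Hypothesis N0 : (0 < N)%N.
Hypothesis A3 : Ck_map 3 A.
Hypothesis detA : forall x, 0 < \det (Dmx A x).
Hypothesis ps : particle_solution (VA A) (KA1 A) x0 x.

Let nu t := empirical (fun i => x i t).

Let mA a : measurable_fun setT (fun y : E => A y 0 a).
Proof. exact: A_coordinate_measurable. Qed.

Let cA a : continuous (fun y => A y 0 a).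
Proof. by move=> y; apply: differentiable_continuous; have [+ _] := A3 a; apply. Qed.

Lemma integrable_empirical (y : 'I_N -> E) (f : E -> R) :
  measurable_fun setT f -> (empirical y).-integrable setT (EFin \o f).
Proof.
move=> mf; apply/integrableP; split; first exact/measurable_EFinP.
have -> : (\int[empirical y]_z `|(EFin \o f) z| =
    \int[empirical y]_z (`|f z|%R)%:E)%E by [].
by rewrite integral_empirical ?ltry//; exact: measurableT_comp.
Qed.

Let velocityE t y :
  velocity (VA A) (KA1 A) (nu t) y = - (vint (nu t) A *m (invmx (Dmx A y))^T).
Proof.
by apply: velocity_conjugate => // a; exact: integrable_empirical.
Qed.

Lemma empirical_narrow (f : 'rV[R]_d -> R) : continuous f ->
  {within `[0, +oo[, continuous (fun t => \int[nu t]_y f y)}.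
Proof.
move=> fc; have mf := continuous_measurable_borel fc.
have -> : (fun t => \int[nu t]_y f y) =
    (fun t => N%:R^-1 * \sum_(i < N) f (x i t)).
  by apply/funext => t; rewrite /Rintegral integral_empirical.
apply: continuous_mul; first exact: cst_continuous.
apply: continuous_bigsum => i.
by have [_ cx _] := ps; exact: within_continuous_comp (cx i) fc.
Qed.

(** The empirical first moment is continuous in time because the trajectories are, and so attains a
    maximum on [0, T]. *)
Lemma empirical_first_moment_bound a (T : R) : exists C : R,
  forall t, 0 <= t <= T -> (\int[nu t]_y `|A y 0 a|%R%:E <= C%:E)%E.
Proof.
have [T0|T0] := leP 0 T; last first.
  by exists 0 => t /andP[t0 tT]; have := le_trans t0 tT; rewrite leNgt T0.
have cn : continuous (fun y => `|A y 0 a|).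
  by apply: continuous_apply (@cA a); exact: norm_continuous.
have nc : {within `[0, T], continuous (fun t => \int[nu t]_y `|A y 0 a|)}.
  apply: continuous_subspaceW (empirical_narrow cn) => t /=.
  by rewrite !in_itv/= andbT => /andP[].
have [c _ cmax] := EVT_max T0 nc.
exists (\int[nu c]_y `|A y 0 a|) => t tT.
have := cmax t; rewrite in_itv/= => /(_ tT).
by rewrite /Rintegral integral_empirical ?lee_fin//; exact: continuous_measurable_borel.
Qed.

(** In the coordinates A every particle has the same velocity, minus the empirical mean, and
    averaging over the particles closes the equation. *)
Lemma empirical_decay t : 0 <= t ->
  vint (nu t) A = expR (- t) *: vint (nu 0) A.
Proof.
rewrite le_eqVlt => /predU1P[<-|t0]; first by rewrite oppr0 expR0 scale1r.
apply/rowP => a; rewrite [RHS]mxE.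
have uE s : (vint (nu s) A) 0 a = N%:R^-1 * \sum_(i < N) A (x i s) 0 a.
  by rewrite mxE integral_empirical.
apply: (@ode_exponential_decay _ (fun s => (vint (nu s) A) 0 a)) => //.
  have -> : (fun s => (vint (nu s) A) 0 a) = (fun s => \int[nu s]_y A y 0 a).
    by apply/funext => s; rewrite mxE.
  apply: continuous_subspaceW (empirical_narrow (@cA a)) => s /=.
  by rewrite !in_itv/= andbT => /andP[].
move=> s /andP[s0 st].
have Di i : is_derive s (1 : R) (fun r => A (x i r) 0 a) (- vint (nu s) A 0 a).
  apply: (@is_derive_along_curve R _ (fun y => A y 0 a) (x i) s _ _ _ (ps_ode ps i s0)).
    by have [+ _] := A3 a; apply.
  apply: is_derive_eq; first exact: is_derive_coordinate.
  by rewrite velocityE mulNmx Dmx_mulVT// mxE.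
have -> : (fun s => (vint (nu s) A) 0 a) =
    cst (N%:R^-1 : R) * (fun s => \sum_(i < N) A (x i s) 0 a).
  by apply/funext => r; rewrite uE.
refine (is_derive_eq (is_deriveM (is_derive_cst (N%:R^-1 : R) s (1 : R))
  (is_derive_bigsum Di (index_enum 'I_N))) _).
have N1 : N%:R != 0 :> R by rewrite pnatr_eq0 -lt0n.
rewrite scaler0 addr0 sumr_const card_ord -[_ *: _]/(N%:R^-1 * _).
by rewrite -(mulr_natl (- vint (nu s) A 0 a) N) (mulKf N1).
Qed.

End particles.

(** * The sample mean *)

Section sample_mean.
Context {R : realType} {d : nat} {disp : measure_display}.
Context {Omega : measurableType disp}.
Variable P : probability Omega R.
Local Notation E := (borelRV R d).
Variables (N : nat) (mu0 : probability E R) (X : 'I_N -> {RV P >-> E}).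
Hypothesis N0 : (0 < N)%N.
Hypothesis lawX : forall i, has_law mu0 (X i).
Hypothesis indepX : mutually_independent X.

Lemma ge0_integral_law (Y : {RV P >-> E}) (g : E -> \bar R) : has_law mu0 Y ->
  measurable_fun setT g -> (forall y, 0 <= g y)%E ->
  (\int[P]_w g (Y w) = \int[mu0]_y g y)%E.
Proof.
move=> lawY mg g0; rewrite -(ge0_integral_distribution Y mg g0).
exact: eq_set_function_integral.
Qed.

Lemma integrable_law (Y : {RV P >-> E}) (g : E -> R) : has_law mu0 Y ->
  mu0.-integrable setT (EFin \o g) ->
  P.-integrable setT (EFin \o (fun w => g (Y w))).
Proof.
move=> lawY ig; have mg := measurable_int _ ig.
apply/integrableP; split.
  exact: (measurableT_comp mg (measurable_funP Y)).
have [_] := integrableP _ _ _ ig.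
rewrite -(@ge0_integral_law Y (fun y => `|(g y)%:E|)%E)//.
exact: measurableT_comp.
Qed.

Lemma integral_law (Y : {RV P >-> E}) (g : E -> R) : has_law mu0 Y ->
  mu0.-integrable setT (EFin \o g) ->
  (\int[P]_w (g (Y w))%:E = \int[mu0]_y (g y)%:E)%E.
Proof.
move=> lawY ig; have mg := measurable_int _ ig.
rewrite -(@integral_distribution _ _ _ _ _ _ Y (EFin \o g) mg).
  exact: eq_set_function_integral.
exact: integrable_law.
Qed.

Lemma pair_law i j (B C : set E) : i != j -> measurable B -> measurable C ->
  P (X i @^-1` B `&` X j @^-1` C) = (mu0 B * mu0 C)%E.
Proof.
(* Mutual independence is specialised to the index set {i, j}. *)
move=> ij mB mC; pose D k := if k == i then B else C.
have mD k : measurable (D k) by rewrite /D; case: ifP.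
have := indepX [set i; j]%SET mD; rewrite big_setU1 ?inE//= big_set1.
rewrite /D eqxx (eq_sym j) (negbTE ij) -(lawX i mB) -(lawX j mC) => <-; congr (P _).
apply/seteqP; split => w /=.
  by move=> [Bw Cw] k /=; rewrite !inE => /orP[]/eqP ->; rewrite ?eqxx// eq_sym (negbTE ij).
move=> DX; split.
  by have := DX i; rewrite /= !inE eqxx; apply.
by have := DX j; rewrite /= !inE eqxx orbT (eq_sym j) (negbTE ij); apply.
Qed.

Variable g : E -> R.
Hypothesis mg : measurable_fun setT g.
Hypothesis g2 : mu0.-integrable setT (fun y => (g y ^+ 2)%:E).
Hypothesis g_centered : (\int[mu0]_y (g y)%:E = 0)%E.

(** Under a probability, square integrability suffices because |g| <= 1 + g^2. *)
Let ig : mu0.-integrable setT (EFin \o g).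
Proof.
have i1 : mu0.-integrable setT (fun y => (cst 1%E y + (g y ^+ 2)%:E)%E).
  by apply: integrableD => //; exact: finite_measure_integrable_cst.
apply: le_integrable i1 => //; first exact/measurable_EFinP.
move=> y _ /=; rewrite lee_fin (ger0_norm (_ : 0 <= 1 + g y ^+ 2)).
  by rewrite ler_norml; apply/andP; split; nra.
by rewrite addr_ge0// sqr_ge0.
Qed.

Let pair_le (a b : R) : `|a * b| <= `|a ^+ 2 + b ^+ 2|.
Proof.
rewrite (ger0_norm (_ : 0 <= a ^+ 2 + b ^+ 2)) ?addr_ge0 ?sqr_ge0//.
by rewrite ler_norml; apply/andP; split; nra.
Qed.

Lemma integrable_pair i j :
  P.-integrable setT (fun w => (g (X i w) * g (X j w))%:E).
Proof.
have i2 k := integrable_law (lawX k) g2.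
have := integrableD measurableT (i2 i) (i2 j).
apply: le_integrable => //.
  apply/measurable_EFinP; apply: measurable_funM.
    exact: (measurableT_comp mg (measurable_funP (X i))).
  exact: (measurableT_comp mg (measurable_funP (X j))).
by move=> w _; rewrite /= lee_fin pair_le.
Qed.

(** The joint law of two distinct samples agrees with the product measure on rectangles, hence
    everywhere. Fubini applies since |g(y) g(z)| <= g(y)^2 + g(z)^2, and the inner integral vanishes
    because [g] is centered. *)
Lemma integral_pair i j : i != j ->
  (\int[P]_w (g (X i w) * g (X j w))%:E = 0)%E.
Proof.
move=> ij.
pose phi w : E * E := (X i w, X j w).
have mphi : measurable_fun setT phi.
  by apply: measurable_fun_pair; exact: measurable_funP.
pose phiM : {mfun Omega >-> (E * E)%type} :=
  MeasurableFun.Pack (MeasurableFun.Class (isMeasurableFun.Build _ _ _ _ _ mphi)).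
pose F (z : E * E) := (g z.1 * g z.2)%:E.
have mg1 : measurable_fun setT (fun z : E * E => g z.1).
  exact: (measurableT_comp mg measurable_fst).
have mg2 : measurable_fun setT (fun z : E * E => g z.2).
  exact: (measurableT_comp mg measurable_snd).
have mF : measurable_fun setT F.
  by apply/measurable_EFinP; exact: measurable_funM.
have prodE (B : set (E * E)) : measurable B ->
    distribution P phiM B = (mu0 \x mu0)%E B.
  move=> mB; apply/esym; apply: (@product_measure_unique _ _ E E R mu0 mu0) mB.
  by move=> B1 B2 mB1 mB2; rewrite -(pair_law ij mB1 mB2).
have fin2 : (\int[mu0]_y (g y ^+ 2)%:E < +oo)%E by exact: integrable_lty g2.
have mg2' : measurable_fun setT (fun y => (g y ^+ 2)%:E).
  exact: measurable_int g2.
have prob1 (r : R) : (\int[mu0]_(y in setT) cst r%:E y = r%:E)%E.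
  by rewrite -[RHS](@expectation_cst _ E R mu0 r) unlock.
have iF1 : (mu0 \x mu0)%E.-integrable setT (fun z : E * E => (g z.1 ^+ 2)%:E).
  apply/integrable12ltyP.
    by apply/measurable_EFinP; exact: measurable_funX.
  under eq_integral do [under eq_integral do rewrite /= ger0_norm ?sqr_ge0//].
  by under eq_integral do rewrite prob1.
have iF2 : (mu0 \x mu0)%E.-integrable setT (fun z : E * E => (g z.2 ^+ 2)%:E).
  apply/integrable12ltyP.
    by apply/measurable_EFinP; exact: measurable_funX.
  under eq_integral do [under eq_integral do rewrite /= ger0_norm ?sqr_ge0//].
  rewrite -(fineK (integrable_fin_num _ g2))//.
  by rewrite prob1 ltry.
have iF : (mu0 \x mu0)%E.-integrable setT F.
  apply: le_integrable (integrableD measurableT iF1 iF2) => //.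
  by move=> z _; rewrite /= lee_fin pair_le.
transitivity (\int[distribution P phiM]_z F z)%E.
  rewrite (@integral_distribution _ _ _ _ _ _ phiM F mF)//.
  exact: integrable_pair.
rewrite (eq_set_function_integral _ prodE) -integral12_prod_meas1//.
rewrite /fubini_F /F /=.
apply: integral0_eq => y _; under eq_integral do rewrite EFinM.
by rewrite integralZl// g_centered mule0.
Qed.

(** The square expands into a sum over pairs of indices. The off-diagonal terms vanish, and the N
    diagonal ones, each weighted by N^-2, leave the factor 1/N. *)
Lemma integral_sqr_sample_mean :
  (\int[P]_w ((N%:R^-1 * \sum_(i < N) g (X i w)) ^+ 2)%:E =
   (N%:R^-1 * \int[mu0]_y g y ^+ 2)%:E)%E.
Proof.
pose h (p : 'I_N * 'I_N) w := (N%:R^-1 ^+ 2 * (g (X p.1 w) * g (X p.2 w)))%:E.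
have hE w : ((N%:R^-1 * \sum_(i < N) g (X i w)) ^+ 2)%:E = (\sum_p h p w)%E.
  rewrite sumEFin exprMn -mulr_sumr; congr (_ * _)%:E.
  rewrite expr2 mulr_suml (eq_bigr _ (fun i _ => mulr_sumr _ _ _ _)).
  by rewrite pair_bigA.
have ih p : P.-integrable setT (h p).
  rewrite /h; under eq_fun do rewrite EFinM.
  by apply: integrableZl => //; exact: integrable_pair.
under eq_integral do rewrite hE.
rewrite integral_sum//.
rewrite (eq_bigr (fun p : 'I_N * 'I_N => (N%:R^-1 ^+ 2 *
    (if p.1 == p.2 then \int[mu0]_y g y ^+ 2 else 0))%:E)); last first.
  move=> [i j] _; rewrite /h; under eq_integral do rewrite EFinM.
  rewrite integralZl//; last exact: integrable_pair.
  rewrite [RHS]EFinM; congr (_ * _)%E => /=; case: eqP => [->|/eqP ij].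
    under eq_integral do rewrite -expr2.
    rewrite (ge0_integral_law (lawX j) (g := fun y => (g y ^+ 2)%:E)).
    - by rewrite /Rintegral fineK//; exact: integrable_fin_num.
    - exact: measurable_int g2.
    - by move=> y; rewrite lee_fin sqr_ge0.
  exact: integral_pair.
rewrite sumEFin -mulr_sumr -(pair_bigA _ (fun i j =>
  if i == j then \int[mu0]_y g y ^+ 2 else 0))/=.
rewrite (eq_bigr (fun=> \int[mu0]_y g y ^+ 2)); last first.
  by move=> i _; rewrite -big_mkcond/= (big_pred1 i)// => j; rewrite eq_sym.
have N1 : N%:R != 0 :> R by rewrite pnatr_eq0 -lt0n.
rewrite sumr_const card_ord -(mulr_natl (\int[mu0]_y g y ^+ 2) N).
by rewrite expr2 -mulrA (mulKf N1).
Qed.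

End sample_mean.

Section euclidean_norm.
Context {R : realType} {d : nat}.
Implicit Types v : 'rV[R]_d.

Lemma sqr_enorm v : enorm v ^+ 2 = \sum_a v 0 a ^+ 2.
Proof. by rewrite sqr_sqrtr ?sumr_ge0// => a _; exact: sqr_ge0. Qed.

Lemma sqr_enorm_scale_le (k : R) v : 0 <= k <= 1 ->
  enorm (k *: v) ^+ 2 <= enorm v ^+ 2.
Proof.
move=> /andP[k0 k1]; rewrite !sqr_enorm; apply: ler_sum => a _.
by rewrite mxE exprMn ler_piMl ?sqr_ge0// expr_le1.
Qed.

End euclidean_norm.

Lemma average_expRN_bounds (R : realType) (T : R) : 0 < T ->
  0 <= T^-1 * \int[lebesgue_measure]_(t in `[0, T]) expR (- t) <= 1.
Proof.
move=> T0; rewrite mulr_ge0/= ?invr_ge0 ?(ltW T0)//; last first.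
  by apply: Rintegral_ge0 => t _; exact: expR_ge0.
rewrite ler_pdivrMl// mulr1.
apply: (@le_trans _ _ (\int[lebesgue_measure]_(t in `[0, T]) (cst 1 t))); last first.
  by rewrite Rintegral_cst//= lebesgue_measure_itv/= lte_fin T0 sube0/= mul1r.
apply: le_Rintegral => //.
- exact: integrable_expRN.
- apply: continuous_compact_integrable; first exact: segment_compact.
  exact/continuous_subspaceT/cst_continuous.
- by move=> t; rewrite /= in_itv/= => /andP[t0 _]; rewrite -expR0 ler_expR oppr_le0.
Qed.

Lemma Ck3_Ck1 (R : realType) (d : nat) (F : 'rV[R]_d -> 'rV[R]_d) :
  Ck_map 3 F -> Ck_map 1 F.
Proof.
move=> F3 a; have [dF CF] := F3 a; split => // b x.
by apply: differentiable_continuous; have [+ _] := CF b; apply.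
Qed.

(** * Mean square of the initial error *)

Section mean_square_error.
Context {R : realType} {d N : nat} {disp : measure_display}.
Context {Omega : measurableType disp} {P : probability Omega R}.
Local Notation E := (borelRV R d).
Variables (A : 'rV[R]_d -> 'rV[R]_d) (mu0 : probability E R).
Variables (X0 : {RV P >-> E}) (X : 'I_N -> {RV P >-> E}).
Hypothesis N0 : (0 < N)%N.
Hypothesis cA : forall a, continuous (fun y => A y 0 a).
Hypothesis law0 : has_law mu0 X0.
Hypothesis lawX : forall i, has_law mu0 (X i).
Hypothesis indepX : mutually_independent X.
Hypothesis second_moment : ('E_P[fun w => (enorm (A (X0 w)) ^+ 2)%R] < +oo)%E.

Let mA a : measurable_fun setT (fun y : E => A y 0 a).
Proof. exact: continuous_measurable_borel (@cA a). Qed.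

Let g a (y : E) := A y 0 a - (vint mu0 A) 0 a.

Let mg a : measurable_fun setT (g a).
Proof. exact: measurable_funB. Qed.

(** The moment hypothesis on [X0] is transferred to its law [mu0], and the squared Euclidean norm
    dominates each squared coordinate. *)
Let iA2 a : mu0.-integrable setT (fun y => (A y 0 a ^+ 2)%:E).
Proof.
have cN : continuous (fun y => enorm (A y) ^+ 2).
  under eq_fun do rewrite sqr_enorm.
  apply: continuous_bigsum => c; under eq_fun do rewrite expr2.
  by apply: continuous_mul; exact: (@cA c).
have mN := continuous_measurable_borel cN.
have iN : mu0.-integrable setT (fun y => (enorm (A y) ^+ 2)%:E).
  apply/integrableP; split; first exact/measurable_EFinP.
  move: second_moment; rewrite unlock.
  rewrite (ge0_integral_law (g := fun y => (enorm (A y) ^+ 2)%:E) law0).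
  - by under [in X in _ -> X]eq_integral do rewrite /= ger0_norm ?sqr_ge0//.
  - exact/measurable_EFinP.
  - by move=> y; rewrite lee_fin sqr_ge0.
apply: le_integrable iN => //.
  by apply/measurable_EFinP; exact: measurable_funX.
move=> y _; rewrite /= lee_fin !ger0_norm ?sqr_ge0// sqr_enorm.
by rewrite (bigD1 a)//= lerDl sumr_ge0// => c _; exact: sqr_ge0.
Qed.

Let iA a : mu0.-integrable setT (fun y => (A y 0 a)%:E).
Proof.
have i1 : mu0.-integrable setT (fun y => (cst 1%E y + (A y 0 a ^+ 2)%:E)%E).
  by apply: integrableD => //; exact: finite_measure_integrable_cst.
apply: le_integrable i1 => //; first exact/measurable_EFinP.
move=> y _ /=; rewrite lee_fin (ger0_norm (_ : 0 <= 1 + A y 0 a ^+ 2)).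
  by rewrite ler_norml; apply/andP; split; nra.
by rewrite addr_ge0// sqr_ge0.
Qed.

Let icst (r : R) : mu0.-integrable setT (fun=> r%:E).
Proof. exact: finite_measure_integrable_cst. Qed.

Let ig2 a : mu0.-integrable setT (fun y => (g a y ^+ 2)%:E).
Proof.
set c := (vint mu0 A) 0 a.
have i1 : mu0.-integrable setT (fun y => (2%:E * (A y 0 a ^+ 2)%:E + (2 * c ^+ 2)%:E)%E).
  by apply: integrableD => //; exact: integrableZl.
apply: le_integrable i1 => //.
  by apply/measurable_EFinP; exact: measurable_funX.
move=> y _; rewrite /= lee_fin !ger0_norm ?sqr_ge0//.
  (* With y_a for the coordinate, (y_a - c)^2 + (y_a + c)^2 = 2 y_a^2 + 2 c^2. *)
  by rewrite /g -/c; have := sqr_ge0 (A y 0 a + c); nra.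
by rewrite addr_ge0// mulr_ge0// sqr_ge0.
Qed.

Let g_centered a : (\int[mu0]_y (g a y)%:E = 0)%E.
Proof.
have Ec : (\int[mu0]_y (cst ((vint mu0 A) 0 a) y)%:E = ((vint mu0 A) 0 a)%:E)%E.
  by rewrite -[RHS](@expectation_cst _ E R mu0) unlock.
under eq_integral do rewrite EFinB.
rewrite (integralB_EFin measurableT (iA a) (icst _)) Ec mxE fineK ?subee//;
  exact: integrable_fin_num.
Qed.

Let varE a : fine (covariance P (fun w => A (X0 w) 0 a) (fun w => A (X0 w) 0 a)) =
  \int[mu0]_y g a y ^+ 2.
Proof.
have EE : fine ('E_P[fun w => A (X0 w) 0%R a])%E = (vint mu0 A) 0 a.
  rewrite unlock mxE; congr fine.
  exact: (integral_law (g := fun y => A y 0 a) law0 (iA a)).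
rewrite covariance.unlock EE unlock /Rintegral; congr fine.
rewrite -(ge0_integral_law (g := fun y => (g a y ^+ 2)%:E) law0).
- by apply: eq_integral => w _; rewrite expr2.
- exact: measurable_int (ig2 a).
- by move=> y; rewrite lee_fin sqr_ge0.
Qed.

(** The squared norm splits over coordinates. Each coordinate is the sample mean of a centered
    function, and its variance is a diagonal entry of the covariance matrix. *)
Lemma mean_square_error :
  (\int[P]_w (enorm (vint (empirical (fun i => X i w)) A - vint mu0 A) ^+ 2)%:E =
   (\tr (cov_mx P (fun w => A (X0 w))) / N%:R)%:E)%E.
Proof.
have N1 : N%:R != 0 :> R by rewrite pnatr_eq0 -lt0n.
have EW w : (enorm (vint (empirical (fun i => X i w)) A - vint mu0 A) ^+ 2)%:E =
    (\sum_a ((N%:R^-1 * \sum_(i < N) g a (X i w)) ^+ 2)%:E)%E.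
  rewrite sqr_enorm sumEFin; congr _%:E; apply: eq_bigr => a _.
  rewrite vint_empirical// 3!mxE summxE; congr (_ ^+ 2).
  rewrite /g sumrB mulrBr sumr_const card_ord -(mulr_natl ((vint mu0 A) 0 a) N).
  by rewrite (mulKf N1).
under eq_integral do rewrite EW.
rewrite ge0_integral_sum//; last 2 first.
- move=> a; apply/measurable_EFinP; apply: measurable_funX.
  apply: measurable_funM => //; apply: measurable_sum => i.
  exact: (measurableT_comp (mg a) (measurable_funP (X i))).
- by move=> a w _; rewrite lee_fin sqr_ge0.
rewrite (eq_bigr (fun a => (N%:R^-1 * \int[mu0]_y g a y ^+ 2)%:E)); last first.
  by move=> a _; rewrite (integral_sqr_sample_mean N0 lawX indepX (mg a)).
rewrite sumEFin mulrC mulr_sumr /mxtrace; congr _%:E.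
by apply: eq_bigr => a _; rewrite mxE varE.
Qed.

End mean_square_error.

Theorem corollary5p11 (R : realType) (d N : nat)
    (A : 'rV[R]_d -> 'rV[R]_d)
    (disp : measure_display) (Omega : measurableType disp)
    (P : probability Omega R)
    (mu0 : probability (borelRV R d) R)
    (X0 : {RV P >-> borelRV R d})
    (Xinit : 'I_N -> {RV P >-> borelRV R d})
    (X : 'I_N -> R -> Omega -> 'rV[R]_d)
    (mu : R -> probability (borelRV R d) R) :
  (0 < N)%N ->
  Ck_diffeo 3 A ->
  orientation_preserving A ->
  has_law mu0 X0 ->
  (forall i, has_law mu0 (Xinit i)) ->
  mutually_independent Xinit ->
  ('E_P[fun w => (enorm (A (X0 w)) ^+ 2)%R] < +oo)%E ->
  mean_field_solution (VA A) (KA1 A) mu0 mu ->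
  (forall w, particle_solution (VA A) (KA1 A)
    (fun i => Xinit i w) (fun i t => X i t w)) ->
  (\int[P]_w ereal_sup
      [set (dA1 A (empirical (fun i => X i t w)) (mu t) ^+ 2)%:E
        | t in [set t : R | (0 <= t)%R]]
    <= (\tr (cov_mx P (fun w => A (X0 w))) / N%:R)%:E)%E
  /\
  (\int[P]_w ereal_sup
      [set (dA1 A (time_average T (fun t => empirical (fun i => X i t w)))
                  (time_average T mu) ^+ 2)%:E
        | T in [set T : R | (0 < T)%R]]
    <= (\tr (cov_mx P (fun w => A (X0 w))) / N%:R)%:E)%E.
Proof.
move=> N0 [A3 [G [AG _ G3]]] detA law0 lawX indepX mom mf ps.
have Ainv : exists2 G, cancel A G & Ck_map 1 G by exists G => //; exact: Ck3_Ck1.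
have mA a : measurable_fun setT (fun y : borelRV R d => A y 0 a).
  exact: A_coordinate_measurable.
pose nu w t : giry (borelRV R d) R := empirical (fun i => X i t w).
pose nu' t : giry (borelRV R d) R := mu t.
pose Z w := vint (empirical (fun i => Xinit i w)) A - vint mu0 A.
have nu0 w : vint (nu w 0) A = vint (empirical (fun i => Xinit i w)) A.
  rewrite /nu; congr (vint (empirical _) A); apply/funext => i.
  by have [] := ps w.
have mu00 : vint (mu 0) A = vint mu0 A.
  apply/rowP => a; rewrite !mxE; congr fine.
  by apply: eq_set_function_integral => B mB; exact: mf_init mf _ mB.
(* Both suprema are compared with the initial error [Z] at each outcome. Nonnegativity is required
   because the integrals are compared without measurability of [f]. *)
have main (f : Omega -> \bar R) : (forall w, 0 <= f w)%E ->
    (forall w, f w <= (enorm (Z w) ^+ 2)%:E)%E ->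
    (\int[P]_w f w <= (\tr (cov_mx P (fun w => A (X0 w))) / N%:R)%:E)%E.
  move=> f0 fZ; apply: le_trans (le_integral_nonmeasurable P f0 fZ) _.
  rewrite (mean_square_error N0 _ law0 lawX indepX mom)// => a y.
  by apply: differentiable_continuous; have [+ _] := A3 a; apply.
have decay w t : 0 <= t ->
    vint (nu w t) A - vint (mu t) A = expR (- t) *: Z w.
  move=> t0; rewrite (empirical_decay N0 A3 detA (ps w) t0).
  by rewrite (mean_field_decay A3 Ainv detA mf t0) -scalerBr nu0 mu00.
have average_decay w T : 0 < T ->
    vint (time_average T (nu w)) A - vint (time_average T mu) A =
    (T^-1 * \int[lebesgue_measure]_(t in `[0, T]) expR (- t)) *: Z w.
  move=> T0.
  rewrite (@vint_time_average_decay _ _ A (nu w) (vint (nu w 0) A) mA)//; last 3 first.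
  - by move=> f fc _; exact: (empirical_narrow (ps w) fc).
  - by move=> a S; exact: (empirical_first_moment_bound A3 (ps w) a S).
  - by move=> t t0; exact: (empirical_decay N0 A3 detA (ps w) t0).
  rewrite (@vint_time_average_decay _ _ A nu' (vint (mu 0) A) mA)//; last 3 first.
  - exact: mf_narrow mf.
  - exact: (mean_field_first_moment_bound A3 Ainv detA mf).
  - by move=> t t0; exact: (mean_field_decay A3 Ainv detA mf t0).
  by rewrite -scalerBr nu0 mu00.
split; apply: main => w.
(* A supremum of squares over a nonempty set is nonnegative: time 0 is a witness here. For the
   averages, where T > 0, the witness is 1. *)
- apply: le_trans (ereal_sup_ubound _); last by exists 0 => //=.
  by rewrite lee_fin sqr_ge0.
- apply: ge_ereal_sup => _ [t t0 <-]; rewrite lee_fin /dA1 (decay w t t0).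
  by apply: sqr_enorm_scale_le; rewrite expR_ge0 -expR0 ler_expR oppr_le0.
- apply: le_trans (ereal_sup_ubound _); last by exists 1 => //=; exact: ltr01.
  by rewrite lee_fin sqr_ge0.
- apply: ge_ereal_sup => _ [T T0 <-]; rewrite lee_fin /dA1 (average_decay w T T0).
  by apply: sqr_enorm_scale_le; exact: average_expRN_bounds.
Qed.
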